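(* Assume that $$\lim_{n\to\infty}\frac{1}{n}\log\left\|\log S_n\right\| = 0 .$$ Then Euler's constant $\gamma$ is irrational, but is not a super Liouville number. More precisely, the irrationality base of $\gamma$ satisfies $\beta(\gamma)\le 2e$, that is, for any $\varepsilon>0$ there exists $q(\varepsilon)>0$ such that $$\left|\gamma-\frac{p}{q}\right| > \frac{1}{(2e+\varepsilon)^q}\quad\text{for all integers } p,q \text{ with } q\ge q(\varepsilon).$$
   Context: $\gamma=\lim_{N\to\infty}\left(1+\frac12+\cdots+\frac1N-\log N\right)$ is Euler's constant. $\log$ is the natural logarithm. For real $t$, $\|t\|$ denotes the distance from $t$ to the nearest integer. For a positive integer $n$, $d_n$ denotes the least common multiple of $1,2,\dots,n$, and $S_n$ is the positive integer $$S_n=\prod_{m=1}^{n}\ \prod_{k=0}^{\min(m-1,\,n-m)}\ \prod_{j=k+1}^{n-k}(n+m)^{\binom{n}{k}^2\frac{2d_{2n}}{j}} .$$ Irrationality base: let $\alpha$ be an irrational real number. If there exists a real number $\beta\ge 1$ with the property that for any $\varepsilon>0$ there is a positive integer $q(\varepsilon)$ such that $\left|\alpha-\frac pq\right|>\frac{1}{(\beta+\varepsilon)^q}$ for all integers $p,q$ with $q\ge q(\varepsilon)$, then the least such $\beta$ is denoted $\beta(\alpha)$ and called the irrationality base of $\alpha$. If no such $\beta$ exists, one writes $\beta(\alpha)=\infty$ and calls $\alpha$ a super Liouville number. *)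

(* Defs.v *)
From mathcomp Require Import all_boot all_order all_algebra.
From mathcomp Require Import all_classical all_reals all_analysis.
Set Implicit Arguments.
Unset Strict Implicit.
Unset Printing Implicit Defensive.
Import Order.TTheory GRing.Theory Num.Theory.
Import numFieldNormedType.Exports.
Local Open Scope classical_set_scope.
Local Open Scope ring_scope.

Definition euler_gamma (R : realType) : R :=
  limn (fun N : nat => (\sum_(1 <= k < N.+1) k%:R^-1) - ln N%:R : R).

Definition dist_int (R : realType) (t : R) : R :=
  inf [set `|t - m%:~R| | m in [set: int]].

Definition lcm_upto (n : nat) : nat := \big[lcmn/1%N]_(1 <= i < n.+1) i.

(* The division by j is exact, since 1 <= j <= n.  The upper bounds of the
   products are inclusive in the mathematical definition, hence the .+1. *)
Definition sondowS (n : nat) : nat :=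
  (\prod_(1 <= m < n.+1)
    \prod_(0 <= k < (minn m.-1 (n - m)).+1)
      \prod_(k.+1 <= j < (n - k).+1)
        (n + m) ^ ('C(n, k) ^ 2 * (2 * lcm_upto n.*2 %/ j)))%N.

(* The admissible bases of alpha.  The denominators q are bounded below by a
   positive integer, so they are represented as natural numbers. *)
Definition irrationality_bases (R : realType) (alpha : R) : set R :=
  [set beta | 1 <= beta /\
    forall eps : R, 0 < eps ->
      exists2 q0 : nat, (0 < q0)%N &
        forall (p : int) (q : nat), (q0 <= q)%N ->
          `|alpha - p%:~R / q%:R| > ((beta + eps) ^+ q)^-1].

(* The least admissible base, and +oo if there is none; meaningful for
   irrational alpha. *)
Definition irrationality_base (R : realType) (alpha : R) : \bar R :=
  xget +oo%E
    [set beta%:E | beta in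
      irrationality_bases alpha `&` lbound (irrationality_bases alpha)].

Definition super_liouville (R : realType) (alpha : R) : Prop :=
  irrational alpha /\ irrationality_bases alpha = set0.

(* Main.v *)
(* Integrating the square of the partial fraction expansion of
   n! / (x (x+1) ... (x+n)) over [nu, +oo[ and summing over nu > n gives
   Sondow's linear form
     0 <= 'C(2n, n) gamma - A_n + L_n <= ((n+1) / 'C(2n, n)) ^ 2,
   where d_2n A_n is an integer and d_2n L_n = log S_n.  If
   |gamma - p/q| <= (2e + eps)^-q, take 2n equal to q or q + 1: then q divides
   d_2n, so log S_n is within d_2n 16^-n n^O(1) + d_2n 'C(2n, n) (2e + eps)^-q of
   an integer.  As d_2n <= e^((1 + o(1)) 2n), this is exponentially small, contrary
   to the hypothesis.

   The bound on d_n is the prime number theorem psi(N) ~ N for psi(N) = log d_N,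
   proved by Selberg's elementary method.  Moebius inversion applied to
   log N! = sum_k psi(N / k) yields, for r(N) = psi(N) - N,
     |r(N)| log^2 N <= 2 sum_(n <= N) |r(N / n)| log n + O(N log N).
   Since sum_n r(n) / (n (n+1)) is bounded and r is almost 1-Lipschitz, r(N / n) is
   small for a positive (logarithmic) proportion of the n <= N, so the right-hand
   side improves any bound |r(N)| <= alpha N + O(1) with alpha > 0. *)
Require Import Defs.
From mathcomp Require Import all_boot all_order all_algebra.
From mathcomp Require Import all_classical all_reals all_analysis.
From mathcomp Require Import ring lra zify.
Set Implicit Arguments.
Unset Strict Implicit.
Unset Printing Implicit Defensive.
Import Order.TTheory GRing.Theory Num.Theory.
Import numFieldNormedType.Exports.
Local Open Scope classical_set_scope.
Local Open Scope ring_scope.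

(** * Elementary bounds for logarithms, harmonic numbers and Euler's constant *)

Section Logarithms.
Context {R : realType}.
Implicit Types (a b : R) (m n N : nat).

(** The base 2e is the growth rate of d_2n 'C(2n, n), the factor that multiplies the error gamma -
    p/q: it is (2e)^(2n) up to subexponential terms, and 2n is the least even number not below q. A
    Chebyshev bound psi(N) <= c N would turn 2e into 2e^c, hence the recourse to the prime number
    theorem. The other term, d_2n 'C(2n, n)^-2, decays like (e/4)^(2n), where crude constants
    suffice. Both halves stay discrete. psi is taken at integers only, with [N %/ n] for N / n, and
    the rounding is absorbed by the error O(N) of Selberg's formula. No integral is formed either:
    its closed form is studied directly, through its derivative and its limit 0 at infinity. *)

Lemma ln_sub_le a b : 0 < a -> 0 < b -> ln b - ln a <= b / a - 1.
Proof.
move=> a0 b0; rewrite -ln_div ?posrE//.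
have ba : 0 < b / a by rewrite divr_gt0.
have := @le_ln1Dx R (b / a - 1).
rewrite [1 + _]addrC subrK; apply; lra.
Qed.

(** As [ln 0 = 0], this function is monotone and nonnegative on all of nat, 0 included. *)
Definition lnn n : R := ln n%:R.

Lemma lnn_ge0 n : 0 <= lnn n.
Proof.
case: n => [|n]; first by rewrite /lnn ln0.
by rewrite ln_ge0// ler1n.
Qed.

Lemma lnn1 : lnn 1 = 0. Proof. exact: ln1. Qed.

Lemma lnn_gt0 n : (1 < n)%N -> 0 < lnn n.
Proof. by move=> n1; rewrite ln_gt0// ltr1n. Qed.

Lemma lnn_le m n : (m <= n)%N -> lnn m <= lnn n.
Proof.
case: m => [|m] mn; first by rewrite {1}/lnn ln0// lnn_ge0.
by rewrite ler_ln ?posrE ?ltr0n ?ler_nat// (leq_trans _ mn).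
Qed.

Lemma lnnM m n : (0 < m)%N -> (0 < n)%N -> lnn (m * n) = lnn m + lnn n.
Proof. by move=> m0 n0; rewrite /lnn natrM lnM// posrE ltr0n. Qed.

Lemma lnnX m k : (0 < m)%N -> lnn (m ^ k) = k%:R * lnn m.
Proof. by move=> m0; rewrite /lnn natrX lnXn ?ltr0n// mulr_natl. Qed.

Lemma lnnS_le n : (0 < n)%N -> lnn n.+1 - lnn n <= n%:R^-1.
Proof.
move=> n0; have n0' : 0 < n%:R :> R by rewrite ltr0n.
apply: le_trans (ln_sub_le _ _) _ => //.
by rewrite -natr1 mulrDl divff ?gt_eqF// mul1r addrAC subrr add0r.
Qed.

Lemma lnnS_ge n : (0 < n)%N -> n.+1%:R^-1 <= lnn n.+1 - lnn n.
Proof.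
move=> n0; have n0' : 0 < n%:R :> R by rewrite ltr0n.
have := @ln_sub_le n.+1%:R n%:R (ltr0Sn _ _) n0'.
have -> : n%:R / n.+1%:R - 1 = - n.+1%:R^-1 :> R.
  by rewrite -natr1; field; rewrite natr1 pnatr_eq0.
rewrite -/(lnn _) -/(lnn _) -[- _^-1]/(- (_^-1)); set x := _^-1; lra.
Qed.

Lemma lnn_lt n : (0 < n)%N -> lnn n < n%:R.
Proof. by move=> n0; rewrite ln_sublinear// ltr0n. Qed.

Definition harm n : R := \sum_(1 <= k < n.+1) k%:R^-1.

Lemma harm0 : harm 0 = 0.
Proof. by rewrite /harm big_geq. Qed.

Lemma harmS n : harm n.+1 = harm n + n.+1%:R^-1.
Proof. by rewrite /harm big_nat_recr. Qed.

Lemma harm_sub_lnn_nincr n k : (0 < n)%N ->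
  harm (n + k) - lnn (n + k) <= harm n - lnn n.
Proof.
move=> n0; elim: k => [|k ih]; first by rewrite addn0.
rewrite addnS harmS; have := @lnnS_ge (n + k); rewrite addn_gt0 n0.
move=> /(_ isT); set x := _^-1; lra.
Qed.

Lemma harm_sub_lnnS_ndecr n k : harm n - lnn n.+1 <= harm (n + k) - lnn (n + k).+1.
Proof.
elim: k => [|k ih]; first by rewrite addn0.
rewrite addnS harmS; have := @lnnS_le (n + k).+1 isT; set x := _^-1; lra.
Qed.

Lemma euler_gamma_bounds n : (0 < n)%N ->
  harm n - lnn n.+1 <= euler_gamma R <= harm n - lnn n.
Proof.
move=> n0.
(* The shift leaves out N = 0, where [ln 0 = 0] gives the value 0 and breaks the monotonicity. *)
pose u := fun N : nat => harm N.+1 - lnn N.+1.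
have u_lb k : harm n - lnn n.+1 <= harm (n + k) - lnn (n + k).
  apply: le_trans (harm_sub_lnnS_ndecr n k) _.
  by rewrite lerD2l lerN2 lnn_le.
have u_ni : nonincreasing_seq u.
  move=> i j ij; rewrite /u -(subnK ij) addnC -addSn; exact: harm_sub_lnn_nincr.
have u_b : has_lbound (range u).
  exists 0 => _ [k _ <-]; rewrite /u.
  have := harm_sub_lnnS_ndecr 0 k.+1; rewrite add0n harm0 lnn1.
  by have := @lnn_le k.+1 k.+2 (leqnSn _); lra.
have cu : cvgn u by apply: nonincreasing_is_cvgn.
have cu' : (fun N => harm N - lnn N) @ \oo --> limn u.
  by rewrite -(cvg_shiftS (fun N => harm N - lnn N)).
have -> : euler_gamma R = limn u by apply/cvg_lim.
apply/andP; split.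
  apply: limr_ge => //; exists n => // k /= nk; rewrite /u.
  have := u_lb (k.+1 - n)%N; rewrite subnKC//; exact: leqW.
case: n n0 {u_lb} => // n _.
exact: (nonincreasing_cvgn_ge u_ni cu n).
Qed.

Lemma ln_fact n : ln n`!%:R = \sum_(1 <= k < n.+1) lnn k :> R.
Proof.
elim: n => [|n ih]; first by rewrite big_geq// fact0 ln1.
rewrite big_nat_recr//= -ih factS natrM lnM ?posrE ?ltr0n ?fact_gt0// addrC//.
Qed.

Definition lnfact n : R := ln n`!%:R.

Lemma lnfactS n : lnfact n.+1 = lnfact n + lnn n.+1.
Proof. by rewrite /lnfact !ln_fact big_nat_recr. Qed.

Lemma lnfact0 : lnfact 0 = 0. Proof. by rewrite /lnfact fact0 ln1. Qed.

Lemma lnfact_ge n : n%:R * lnn n - n%:R <= lnfact n.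
Proof.
elim: n => [|n ih]; first by rewrite mul0r subr0 lnfact0.
rewrite lnfactS; case: n ih => [|n] ih.
  by rewrite !mul1r lnfact0 lnn1; lra.
have := @lnnS_le n.+1 isT.
have n0 : 0 < n.+1%:R :> R by rewrite ltr0Sn.
rewrite -(ler_pM2l n0) mulfV ?gt_eqF// -[n.+2%:R]natr1; nra.
Qed.

Lemma lnfact_le n : lnfact n <= n%:R * lnn n - n%:R + 1 + lnn n.
Proof.
elim: n => [|n ih]; first by rewrite mul0r subr0 lnfact0 /lnn ln0; lra.
rewrite lnfactS; case: n ih => [|n] ih.
  by rewrite !mul1r lnfact0 lnn1; lra.
have := @lnnS_ge n.+1 isT.
have n0 : 0 < n.+2%:R :> R by rewrite ltr0Sn.
rewrite -(ler_pM2l n0) mulfV ?gt_eqF// -[n.+2%:R]natr1; nra.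
Qed.

Lemma sum_ln_div N : (0 < N)%N ->
  \sum_(1 <= d < N.+1) (lnn N - lnn d) <= N%:R.
Proof.
move=> N0; rewrite sumrB -ln_fact sumr_const_nat subSS subn0 -[lnn N *+ N]mulr_natl.
have := lnfact_ge N; rewrite /lnfact; lra.
Qed.

Lemma sum_ln_div_sqr N : (0 < N)%N ->
  \sum_(1 <= d < N.+1) (lnn N - lnn d) ^+ 2 <= 3 * N%:R.
Proof.
elim: N => // -[|N] ih _.
  by rewrite big_nat1 subrr expr0n/=; lra.
rewrite big_nat_recr//= subrr expr0n /= addr0.
set e := lnn N.+2 - lnn N.+1.
have e0 : 0 <= e by rewrite subr_ge0 lnn_le.
have e1 : N.+1%:R * e <= 1.
  have := @lnnS_le N.+1 isT; rewrite -/e.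
  have n0 : 0 < N.+1%:R :> R by rewrite ltr0Sn.
  by rewrite -(ler_pM2l n0) mulfV ?gt_eqF.
have -> : \sum_(1 <= d < N.+2) (lnn N.+2 - lnn d) ^+ 2 =
   \sum_(1 <= d < N.+2) (lnn N.+1 - lnn d) ^+ 2
   + 2 * e * \sum_(1 <= d < N.+2) (lnn N.+1 - lnn d) + N.+1%:R * e ^+ 2.
  have -> : N.+1%:R * e ^+ 2 = \sum_(1 <= d < N.+2) e ^+ 2.
    by rewrite sumr_const_nat subSS subn0 -[RHS]mulr_natl.
  rewrite mulr_sumr.
  by rewrite -!big_split/=; apply: eq_bigr => d _; rewrite /e; ring.
have := ih isT; have := @sum_ln_div N.+1 isT.
set A := \sum_(1 <= d < _) _; set B := \sum_(1 <= d < _) _ => hA hB.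
have e2 : e <= 1.
  apply: le_trans e1; rewrite -{1}[e]mul1r ler_wpM2r// ler1n//.
have : N.+1%:R * e ^+ 2 <= 1.
  by rewrite expr2 mulrA; apply: le_trans e2; have := ler_wpM2r e0 e1; rewrite mul1r.
have : e * A <= 1 by apply: le_trans e1; rewrite mulrC ler_wpM2r.
rewrite -[N.+2%:R]natr1; lra.
Qed.

Lemma harm_le n : (0 < n)%N -> harm n <= 1 + lnn n.
Proof.
case: n => // n _; have := @harm_sub_lnn_nincr 1 n isT.
by rewrite add1n (harmS 0) harm0 lnn1 add0r invr1; lra.
Qed.

Lemma harm_ge n : lnn n.+1 <= harm n.
Proof. by have := harm_sub_lnnS_ndecr 0 n; rewrite add0n harm0 lnn1; lra. Qed.

End Logarithms.
Arguments lnn R n : clear implicits.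
Arguments harm R n : clear implicits.
Arguments lnfact R n : clear implicits.

(** * Arithmetic functions *)

Section DivisorSums.
Variable V : nmodType.
Implicit Types (N m n : nat).

(** Both sides run over the pairs with m j <= N, on the right grouped by n = m j. In the induction
    [N %/ m] grows exactly when m divides [N.+1]. *)
Lemma sum_divisor_pairs N (f : nat -> nat -> V) :
  \sum_(1 <= m < N.+1) \sum_(1 <= j < (N %/ m).+1) f m j =
  \sum_(1 <= n < N.+1) \sum_(1 <= m < n.+1 | (m %| n)%N) f m (n %/ m)%N.
Proof.
elim: N => [|N ih]; first by rewrite !big_geq.
rewrite [RHS]big_nat_recr//= -ih [LHS]big_nat_recr//= divnn/= big_nat1.
rewrite [X in _ = _ + X]big_mkcond [X in _ = _ + X]big_nat_recr//= dvdnn divnn/=.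
rewrite addrA; congr +%R; rewrite -big_split/=.
rewrite big_nat [RHS]big_nat; apply: eq_bigr => m /andP[m0 mN].
rewrite divnS//; case: (m %| N.+1)%N; last by rewrite addr0 add0n.
by rewrite /= add1n big_nat_recr.
Qed.

Lemma sum_hyperbola_swap N (f : nat -> nat -> V) :
  \sum_(1 <= a < N.+1) \sum_(1 <= b < (N %/ a).+1) f a b =
  \sum_(1 <= b < N.+1) \sum_(1 <= a < (N %/ b).+1) f a b.
Proof.
have E (g : nat -> nat -> V) : \sum_(1 <= a < N.+1) \sum_(1 <= b < (N %/ a).+1) g a b =
    \sum_(1 <= a < N.+1) \sum_(1 <= b < N.+1) (if (a * b <= N)%N then g a b else 0).
  rewrite big_nat [RHS]big_nat; apply: eq_bigr => a /andP[a0 aN].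
  rewrite (@big_nat_widen _ _ _ 1 _ N.+1) ?ltnS ?leq_div//= big_mkcond/=.
  by apply: eq_bigr => b _; rewrite ltnS leq_divRL// mulnC.
rewrite E (E (fun b a => f a b)) exchange_big/=.
by apply: eq_bigr => b _; apply: eq_bigr => a _; rewrite mulnC.
Qed.

Lemma sum_multiples p M (g : nat -> V) : (0 < p)%N ->
  \sum_(1 <= d < M.+1 | (p %| d)%N) g d = \sum_(1 <= e < (M %/ p).+1) g (p * e)%N.
Proof.
move=> p0; elim: M => [|M ih]; first by rewrite div0n !big_geq.
rewrite big_mkcond big_nat_recr//= -big_mkcond/= ih divnS//.
have e : (p %| M.+1 -> p * ((p %| M.+1) + M %/ p) = M.+1)%N.
  by move=> pM; rewrite -divnS// mulnC divnK.
case: (p %| M.+1)%N e => /= e; last by rewrite addr0 add0n.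
by rewrite add1n in e *; rewrite [RHS]big_nat_recr//= e.
Qed.

End DivisorSums.

(** * Prime exponents of d_n and Chebyshev's identity *)

Section LcmUpto.
Implicit Types (n N p : nat).

Lemma lcm_upto0 : lcm_upto 0 = 1%N.
Proof. by rewrite /lcm_upto big_geq. Qed.

Lemma lcm_uptoS n : lcm_upto n.+1 = lcmn (lcm_upto n) n.+1.
Proof. by rewrite /lcm_upto big_nat_recr. Qed.

Lemma lcm_upto_gt0 n : (0 < lcm_upto n)%N.
Proof.
elim: n => [|n ih]; first by rewrite lcm_upto0.
by rewrite lcm_uptoS lcmn_gt0 ih.
Qed.

Lemma dvdn_lcm_upto i n : (0 < i <= n)%N -> (i %| lcm_upto n)%N.
Proof.
move=> /andP[i0]; elim: n => [|n ih]; first by case: i i0.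
rewrite leq_eqVlt lcm_uptoS => /orP[/eqP->|]; first exact: dvdn_lcmr.
by rewrite ltnS => /ih h; apply: dvdn_trans h (dvdn_lcml _ _).
Qed.

Lemma logn_lcm_upto p n : prime p -> logn p (lcm_upto n) = trunc_log p n.
Proof.
move=> pp; have p1 := prime_gt1 pp; apply/eqP; rewrite eqn_leq; apply/andP; split.
  elim: n => [|n ih]; first by rewrite lcm_upto0 logn1.
  rewrite lcm_uptoS logn_lcm ?lcm_upto_gt0// geq_max; apply/andP; split.
    by apply: leq_trans ih _; apply: leq_trunc_log.
  by apply: trunc_log_max => //; apply: dvdn_leq => //; apply: pfactor_dvdnn.
case: n => [|n]; first by rewrite trunc_log0.
rewrite -pfactor_dvdn ?lcm_upto_gt0//; apply: dvdn_lcm_upto.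
by rewrite expn_gt0 prime_gt0//= trunc_logP.
Qed.

Lemma logn_prod_nat p a b (F : nat -> nat) : (forall i, 0 < F i)%N ->
  (0 < \prod_(a <= i < b) F i)%N /\
  logn p (\prod_(a <= i < b) F i) = (\sum_(a <= i < b) logn p (F i))%N.
Proof.
move=> F0; apply: (big_ind2 (fun x y => 0 < x /\ logn p x = y)%N).
- by rewrite logn1.
- by move=> x y x' y' [x0 <-] [x'0 <-]; rewrite muln_gt0 x0 x'0 lognM.
- by move=> i _; rewrite F0.
Qed.

Lemma sum_nat_leq N t : (t <= N)%N -> (\sum_(1 <= j < N.+1) (j <= t) = t)%N.
Proof.
elim: N t => [|N ih] t; first by rewrite leqn0 => /eqP ->; rewrite big_geq.
rewrite leq_eqVlt => /orP[/eqP ->|]; last first.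
  by rewrite ltnS => tN; rewrite big_nat_recr//= ih// leqNgt ltnS tN addn0.
rewrite big_nat [LHS](eq_bigr (fun=> 1%N)); last by move=> i /andP[_]; rewrite ltnS => ->.
by rewrite -big_nat sum_nat_const_nat subSS subn0 muln1.
Qed.

(** The exponent of a prime p on either side is the number of pairs j, k >= 1 with p^j k <= N.
    Taking logarithms gives log N! = sum_k psi(N / k). *)
Lemma prod_lcm_upto N : (\prod_(1 <= k < N.+1) lcm_upto (N %/ k) = N`!)%N.
Proof.
have P p := logn_prod_nat p 1 N.+1 (fun k => lcm_upto_gt0 (N %/ k)).
have [P0 _] := P 0%N.
apply: eqn_from_log => //; first exact: fact_gt0.
move=> p; have [pp|npp] := boolP (prime p); last by rewrite lognE [RHS]lognE (negPf npp).
have [_ ->] := P p; rewrite logn_fact//.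
have p1 := prime_gt1 pp.
under eq_bigr do rewrite logn_lcm_upto//.
transitivity (\sum_(1 <= k < N.+1) \sum_(1 <= j < N.+1) (p ^ j * k <= N))%N.
  rewrite big_nat [RHS]big_nat; apply: eq_bigr => k /andP[k0 kN].
  have Nk0 : (0 < N %/ k)%N by rewrite divn_gt0.
  rewrite -[LHS](@sum_nat_leq N).
    apply: eq_bigr => j _; congr nat_of_bool; rewrite -leq_divRL//.
    apply/idP/idP => h; last exact: trunc_log_max.
    by apply: leq_trans (trunc_logP p1 Nk0); rewrite leq_exp2l.
  apply: leq_trans (leq_div N k); apply: leq_trans (trunc_logP p1 Nk0).
  by apply: ltnW; apply: ltn_expl.
rewrite exchange_big/=; apply: eq_bigr => j _.
rewrite -[RHS](@sum_nat_leq N) ?leq_div//; apply: eq_bigr => k _.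
by rewrite leq_divRL ?expn_gt0 ?prime_gt0// mulnC.
Qed.

End LcmUpto.

(** * The Moebius function *)

Section Mobius.
Context {R : realType}.
Implicit Types (n N p : nat).

(** The product is the radical of n, so the test picks out the squarefree n; it fails at n = 0,
    where the product is 1. *)
Definition mobius n : R :=
  if n == (\prod_(p <- primes n) p)%N then (-1) ^+ size (primes n) else 0.

Lemma mobius1 : mobius 1 = 1.
Proof. by rewrite /mobius big_nil expr0. Qed.

Lemma mobius_norm_le1 n : `|mobius n| <= 1.
Proof. by rewrite /mobius; case: ifP => _; rewrite ?normr0// normrX normrN1 expr1n. Qed.

Lemma logn_prod_primes p (s : seq nat) : all prime s -> uniq s -> prime p ->
  logn p (\prod_(q <- s) q) = (p \in s).
Proof.
move=> + + pp; elim: s => [|q s ih]; first by rewrite big_nil logn1.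
rewrite /= => /andP[pq ps] /andP[qs us]; rewrite big_cons in_cons lognM ?(prime_gt0 pq)//.
  rewrite ih// logn_prime//; case: eqP => [->|]//=.
  by rewrite (negPf qs).
elim: s ps {ih qs us} => [|r s ih]; first by rewrite big_nil.
by move=> /andP[pr ps]; rewrite big_cons muln_gt0 prime_gt0// ih.
Qed.

Lemma mobius_square p n : prime p -> (0 < n)%N -> (p ^ 2 %| n)%N -> mobius n = 0.
Proof.
move=> pp n0 pn; rewrite /mobius; case: eqP => // e; exfalso.
move: pn; rewrite pfactor_dvdn// e logn_prod_primes ?primes_uniq//.
  by case: (_ \in _).
by apply/allP => q; rewrite mem_primes => /andP[].
Qed.

Lemma mobius_prime_mul p n : prime p -> (0 < n)%N -> ~~ (p %| n)%N ->
  mobius (p * n) = - mobius n.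
Proof.
move=> pp n0 pn.
have e : perm_eq (primes (p * n)) (p :: primes n).
  apply: uniq_perm => [||q]; first exact: primes_uniq.
    by rewrite /= primes_uniq mem_primes (negPf pn) !andbF.
  by rewrite primesM ?(prime_gt0 pp)// primes_prime// !inE.
rewrite /mobius (perm_big _ e) (perm_size e) big_cons eqn_pmul2l ?prime_gt0//=.
by case: ifP; rewrite ?oppr0// exprS mulN1r.
Qed.

(** Let p be the least prime factor of n. A divisor d prime to p cancels against p d, and the
    divisors divisible by p^2 contribute 0. *)
Lemma sum_mobius_divisors n : (1 < n)%N ->
  \sum_(1 <= d < n.+1 | (d %| n)%N) mobius d = 0.
Proof.
move=> n1; have n0 : (0 < n)%N by lia.
set p := pdiv n; have pp : prime p by apply: pdiv_prime.
have pn : (p %| n)%N by apply: pdiv_dvd.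
have p0 := prime_gt0 pp.
have e_dvd d : ~~ (p %| d)%N -> (d %| n)%N = (p * d %| n)%N.
  by move=> pd; rewrite Gauss_dvd ?pn// prime_coprime.
rewrite (bigID (fun d => p %| d)%N)/=.
under eq_bigl do rewrite andbC.
rewrite big_mkcondr/= sum_multiples//.
under [X in _ + X]eq_bigl do rewrite andbC.
have -> : \sum_(1 <= d < n.+1 | ~~ (p %| d)%N && (d %| n)%N) mobius d =
   \sum_(1 <= d < (n %/ p).+1 | ~~ (p %| d)%N && (d %| n)%N) mobius d.
  rewrite [RHS](@big_nat_widen _ _ _ 1 _ n.+1) ?ltnS ?leq_div//.
  apply: eq_bigl => d; case: (boolP (p %| d)%N) => //= pd.
  case: (boolP (d %| n)%N) => //=; rewrite e_dvd// => /dvdn_leq.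
  by move=> /(_ n0); rewrite ltnS leq_divRL// mulnC => ->.
rewrite [X in _ + X]big_mkcond -big_split/= big_nat big1// => e /andP[e0 _].
have [pe|pe] /= := boolP (p %| e)%N.
  rewrite addr0 (@mobius_square p) ?muln_gt0 ?p0//; first by case: ifP.
  by rewrite -mulnn dvdn_mul.
by rewrite (e_dvd e)//; case: (_ %| n)%N; rewrite ?addr0// mobius_prime_mul// addNr.
Qed.

(** [F k] stands for the value of a function at N / k. Indexing by k rather than by the quotient
    allows the exact fraction N / k next to the floor [N %/ k]. *)
Lemma mobius_inversion N (F : nat -> R) : (0 < N)%N ->
  \sum_(1 <= d < N.+1) mobius d * \sum_(1 <= n < (N %/ d).+1) F (d * n)%N = F 1%N.
Proof.
move=> N0; under eq_bigr do rewrite mulr_sumr.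
rewrite (sum_divisor_pairs N (fun d n => mobius d * F (d * n)%N)).
rewrite big_ltn// big_mkcond/= big_nat1/= mobius1 mul1r big_nat big1 ?addr0//.
move=> n /andP[n1 _].
transitivity (\sum_(1 <= d < n.+1 | (d %| n)%N) (mobius d * F n)).
  by apply: eq_bigr => d dn; rewrite mulnC divnK.
by rewrite -mulr_suml sum_mobius_divisors// mul0r.
Qed.

End Mobius.
Arguments mobius R n : clear implicits.

(** * Chebyshev's function and the von Mangoldt function *)

Section Chebyshev.
Context {R : realType}.
Implicit Types (n N : nat).

Definition psi n : R := lnn R (lcm_upto n).

Lemma psi0 : psi 0 = 0. Proof. by rewrite /psi lcm_upto0 lnn1. Qed.

Lemma psi1 : psi 1 = 0. Proof. by rewrite /psi lcm_uptoS lcm_upto0 lnn1. Qed.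

Lemma psi_ge0 n : 0 <= psi n. Proof. exact: lnn_ge0. Qed.

Lemma psi_leS n : psi n <= psi n.+1.
Proof. by apply: lnn_le; rewrite dvdn_leq ?lcm_upto_gt0// lcm_uptoS dvdn_lcml. Qed.

Lemma psi_le m n : (m <= n)%N -> psi m <= psi n.
Proof.
move=> mn; rewrite -(subnK mn); elim: (_ - _)%N => // k ih.
by apply: le_trans ih _; rewrite addSn psi_leS.
Qed.

Lemma psiS_le n : psi n.+1 <= psi n + lnn R n.+1.
Proof.
rewrite -lnnM ?lcm_upto_gt0//; apply: lnn_le.
by apply: dvdn_leq; [rewrite muln_gt0 lcm_upto_gt0|rewrite lcm_uptoS dvdn_lcm dvdn_mulr// dvdn_mull].
Qed.

Lemma lnn_prod a b (F : nat -> nat) : (forall i, 0 < F i)%N ->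
  lnn R (\prod_(a <= i < b) F i) = \sum_(a <= i < b) lnn R (F i).
Proof.
move=> F0; suff [] : (0 < \prod_(a <= i < b) F i)%N /\
  lnn R (\prod_(a <= i < b) F i) = \sum_(a <= i < b) lnn R (F i) by [].
apply: (big_ind2 (fun x y => (0 < x)%N /\ lnn R x = y)).
- by rewrite lnn1.
- by move=> x y x' y' [x0 <-] [x'0 <-]; rewrite muln_gt0 x0 x'0 lnnM.
- by move=> i _; rewrite F0.
Qed.

Lemma sum_psi_div N : \sum_(1 <= k < N.+1) psi (N %/ k) = lnfact R N.
Proof.
rewrite /lnfact -prod_lcm_upto -/(lnn R _) lnn_prod// => k.
exact: lcm_upto_gt0.
Qed.

(* The logarithm of [p] at the powers of a prime [p], and [0] elsewhere. *)
Definition mangoldt n : R := psi n - psi n.-1.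

Lemma mangoldt_ge0 n : 0 <= mangoldt n.
Proof. by case: n => [|n]; rewrite /mangoldt ?subrr// subr_ge0 psi_leS. Qed.

Lemma psiE N : psi N = \sum_(1 <= n < N.+1) mangoldt n.
Proof.
elim: N => [|N ih]; first by rewrite big_geq// psi0.
by rewrite big_nat_recr//= -ih /mangoldt /= addrC subrK.
Qed.

Lemma sum_mangoldt_div N : \sum_(1 <= n < N.+1) mangoldt n * (N %/ n)%:R = lnfact R N.
Proof.
rewrite -sum_psi_div; under [RHS]eq_bigr do rewrite psiE.
rewrite [RHS](sum_hyperbola_swap N (fun k n => mangoldt n)); apply: eq_bigr => n _.
by rewrite sumr_const_nat subSS subn0 mulr_natr.
Qed.

(** Both sides have the partial sums log N!, so they agree term by term. *)
Lemma sum_mangoldt_divisors n : (0 < n)%N ->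
  \sum_(1 <= d < n.+1 | (d %| n)%N) mangoldt d = lnn R n.
Proof.
have E N : \sum_(1 <= n < N.+1) \sum_(1 <= d < n.+1 | (d %| n)%N) mangoldt d = lnfact R N.
  rewrite -sum_psi_div -(sum_divisor_pairs N (fun d n => mangoldt d)).
  rewrite -(sum_hyperbola_swap N (fun k n => mangoldt n)).
  by apply: eq_bigr => k _; rewrite psiE.
case: n => // n _; have := E n.+1; rewrite lnfactS -E big_nat_recr//=.
exact: addrI.
Qed.

Lemma sum_mul_lnn M (G : nat -> R) :
  \sum_(1 <= n < M.+1) G n * lnn R n =
  \sum_(1 <= m < M.+1) mangoldt m * \sum_(1 <= j < (M %/ m).+1) G (m * j)%N.
Proof.
under [RHS]eq_bigr do rewrite mulr_sumr.
rewrite (sum_divisor_pairs M (fun m j => mangoldt m * G (m * j)%N)).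
rewrite big_nat [RHS]big_nat; apply: eq_bigr => n /andP[n0 _].
rewrite -sum_mangoldt_divisors// mulr_sumr; apply: eq_bigr => d dn.
by rewrite [(d * _)%N]mulnC divnK// mulrC.
Qed.

Lemma mobius_inversion_lnn N (F : nat -> R) : (0 < N)%N ->
  \sum_(1 <= d < N.+1) mobius R d *
     \sum_(1 <= n < (N %/ d).+1) F (d * n)%N * lnn R n =
  \sum_(1 <= m < N.+1) mangoldt m * F m.
Proof.
move=> N0.
transitivity (\sum_(1 <= m < N.+1) \sum_(1 <= d < (N %/ m).+1)
   (mobius R d * (mangoldt m * \sum_(1 <= j < (N %/ m %/ d).+1) F (m * (d * j))%N))).
  rewrite -(sum_hyperbola_swap N (fun d m => mobius R d *
    (mangoldt m * \sum_(1 <= j < (N %/ m %/ d).+1) F (m * (d * j))%N))).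
  apply: eq_bigr => d _; rewrite (sum_mul_lnn _ (fun n => F (d * n)%N)) mulr_sumr.
  apply: eq_bigr => m _; rewrite -!divnMA [(d * m)%N]mulnC.
  by do 2!congr (_ * _); apply: eq_bigr => j _; rewrite mulnCA.
rewrite big_nat [RHS]big_nat; apply: eq_bigr => m /andP[m0 mN].
have := @mobius_inversion R (N %/ m) (fun k => mangoldt m * F (m * k)%N).
rewrite divn_gt0// -ltnS mN muln1 => <- //.
by apply: eq_bigr => d _; rewrite mulr_sumr.
Qed.

(** Write log(N / d) = log(N / (d n)) + log n. Moebius inversion of F(k) log(N / k) leaves F(1) log
    N from the first part; in the second, log n is a divisor sum of [mangoldt], and inversion leaves
    the sum over m. *)
Lemma tatuzawa_iseki N (F : nat -> R) : (0 < N)%N ->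
  \sum_(1 <= d < N.+1) mobius R d *
     ((lnn R N - lnn R d) * \sum_(1 <= n < (N %/ d).+1) F (d * n)%N) =
  F 1%N * lnn R N + \sum_(1 <= m < N.+1) mangoldt m * F m.
Proof.
move=> N0; rewrite -mobius_inversion_lnn//.
have := @mobius_inversion R N (fun k => F k * (lnn R N - lnn R k)) N0.
rewrite lnn1 subr0 => <-; rewrite -big_split/= big_nat [RHS]big_nat.
apply: eq_bigr => d /andP[d0 _]; rewrite -mulrDr; congr (_ * _).
rewrite mulr_sumr -big_split/= big_nat [RHS]big_nat.
by apply: eq_bigr => n /andP[n0 _]; rewrite lnnM//; ring.
Qed.

End Chebyshev.
Arguments psi R n : clear implicits.
Arguments mangoldt R n : clear implicits.

(** * Selberg's inequality *)

Section Selberg.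
Context {R : realType}.
Implicit Types (n N M : nat).
Local Notation ln_ n := (lnn R n).
Local Notation psi n := (psi R n).
Local Notation mangoldt n := (mangoldt R n).
Local Notation gam := (euler_gamma R).

Lemma euler_gamma_ge0 : 0 <= gam.
Proof.
have /andP[h _] := @euler_gamma_bounds R 1 isT; apply: le_trans h.
by rewrite subr_ge0 harm_ge.
Qed.

Lemma euler_gamma_le1 : gam <= 1.
Proof.
have /andP[_ h] := @euler_gamma_bounds R 1 isT; apply: le_trans h _.
by rewrite lnn1 subr0 /harm big_nat1 invr1.
Qed.

Lemma lnfact_le_mul N : lnfact R N <= N%:R * ln_ N.
Proof.
rewrite /lnfact ln_fact mulr_natl -[X in _ *+ X](subn1 N.+1) -sumr_const_nat.
by rewrite big_nat [leRHS]big_nat; apply: ler_sum => k /andP[_ kN]; apply: lnn_le.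
Qed.

Lemma lnn_divn N n : (0 < n <= N)%N -> ln_ (N %/ n) <= ln_ N - ln_ n.
Proof.
move=> /andP[n0 nN]; rewrite lerBrDr -lnnM ?divn_gt0//.
by apply: lnn_le; exact: leq_trunc_div.
Qed.

Lemma divn_bounds N n : (0 < n)%N ->
  (N %/ n)%:R <= N%:R / n%:R :> R /\ N%:R / n%:R < (N %/ n)%:R + 1 :> R.
Proof.
move=> n0; have n0' : 0 < n%:R :> R by rewrite ltr0n.
rewrite ler_pdivlMr// -natrM ler_nat leq_trunc_div; split=> //.
by rewrite ltr_pdivrMr// natr1 -natrM ltr_nat ltn_ceil.
Qed.

(** With x = N / d and M its floor, the sum is log M! - x H_M + (gamma + 1) M. The constant gamma +
    1 is the one for which the linear terms of log M! ~ M log M - M and x H_M ~ x (log M + gamma)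
    cancel, leaving O(1 + log x). *)
Lemma sum_selberg_weight_bound N d : (0 < d <= N)%N ->
  `|\sum_(1 <= n < (N %/ d).+1)
      (psi (N %/ (d * n)) - N%:R / (d * n)%:R + (gam + 1))|
  <= 3 * (1 + (ln_ N - ln_ d)).
Proof.
move=> dN; have /andP[d0 dN'] := dN.
have d0' : d%:R != 0 :> R by rewrite pnatr_eq0 -lt0n.
have := lnn_divn dN; have [] := divn_bounds N d0.
set M := (N %/ d)%N; set x := N%:R / d%:R; set L := ln_ N - ln_ d => Mx xM lL.
have M0 : (0 < M)%N by rewrite divn_gt0.
have -> : \sum_(1 <= n < M.+1) (psi (N %/ (d * n)) - N%:R / (d * n)%:R + (gam + 1))
   = lnfact R M - x * harm R M + (gam + 1) * M%:R.
  rewrite big_split/= sumrB sumr_const_nat subn1/= -[X in _ + X = _]mulr_natr; congr (_ - _ + _).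
    by rewrite -sum_psi_div; apply: eq_bigr => n _; rewrite divnMA.
  rewrite /harm mulr_sumr big_nat [RHS]big_nat; apply: eq_bigr => n /andP[n0 _].
  by rewrite natrM invfM mulrA.
have := @lnfact_le R M; have := @lnfact_ge R M.
have /andP[] := @euler_gamma_bounds R M M0; have := @lnnS_le R M M0.
have := euler_gamma_ge0; have := euler_gamma_le1; have := @lnn_ge0 R M.
have M1 : 1 <= M%:R :> R by rewrite ler1n.
have : M%:R * M%:R^-1 = 1 :> R by rewrite mulfV// gt_eqF// (lt_le_trans _ M1).
have : 0 < M%:R^-1 :> R by rewrite invr_gt0 (lt_le_trans _ M1).
move: (harm R M) (ln_ M.+1) (ln_ M) (M%:R : R) M1 lL Mx xM (M%:R^-1 : R) (lnfact R M).
move=> H lS l m m1 lL mx xm i lf i0 mi l0 g1 g0 hlS hg1 hg2 hf1 hf2.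
have xi : x * i <= 2.
  have := ler_wpM2r (ltW i0) (ltW xm); have := ler_wpM2r (ltW i0) m1.
  by rewrite mulrDl mi !mul1r; lra.
have xm0 : 0 <= x - m by lra.
have x0 : 0 <= x by lra.
rewrite ler_norml; apply/andP; split.
  have : x * H <= x * (gam + l + i) by apply: ler_wpM2l => //; lra.
  have : (x - m) * (gam + l) <= 1 * (gam + l) by apply: ler_wpM2r; lra.
  lra.
have : x * (gam + l) <= x * H by apply: ler_wpM2l => //; lra.
have : 0 <= (x - m) * (gam + l) by apply: mulr_ge0 => //; lra.
lra.
Qed.

Definition psi_rem n : R := psi n - n%:R.

(** Moebius inversion recovers psi(N) - N + gamma + 1 from sums of size 3 (1 + log(N / d)), which
    total at most 6 N; gamma + 1 <= 2 accounts for the rest. *)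
Lemma psi_rem_le N : `|psi_rem N| <= 8 * N%:R.
Proof.
case: N => [|N]; first by rewrite /psi_rem psi0 subrr normr0 mulr0.
set F := fun k => psi (N.+1 %/ k) - N.+1%:R / k%:R + (gam + 1).
have := @mobius_inversion R N.+1 F isT.
rewrite {2}/F divn1 divr1 => e.
have : `|psi N.+1 - N.+1%:R + (gam + 1)| <= 6 * N.+1%:R.
  rewrite -e; apply: le_trans (ler_norm_sum _ _ _) _.
  apply: (@le_trans _ _ (\sum_(1 <= d < N.+2) 3 * (1 + (ln_ N.+1 - ln_ d)))).
    rewrite big_nat [leRHS]big_nat; apply: ler_sum => d dN.
    rewrite normrM -[leRHS]mul1r; apply: ler_pM => //.
      exact: mobius_norm_le1.
    exact: sum_selberg_weight_bound.
  rewrite -mulr_sumr big_split/= sumr_const_nat subn1/=.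
  have := @sum_ln_div R N.+1 isT; lra.
have n1 : 1 <= N.+1%:R :> R by rewrite ler1n.
have := euler_gamma_ge0; have := euler_gamma_le1.
by rewrite /psi_rem !ler_norml => g1 g0 /andP[h1 h2]; apply/andP; split; lra.
Qed.

Lemma psi_le_mul N : psi N <= 9 * N%:R.
Proof. by have := psi_rem_le N; rewrite /psi_rem ler_norml => /andP[_]; lra. Qed.

(** Selberg's formula for the remainder. The constant collects 3 (N + 3 N) from the Moebius sum
    weighted by log(N / d), 2 psi(N) <= 18 N because [F m] minus [psi_rem (N %/ m)] lies in [0, 2],
    and 2 N for (gamma + 1) log N. *)
Lemma psi_rem_selberg N : `|psi_rem N * ln_ N + \sum_(1 <= k < N.+1) mangoldt k * psi_rem (N %/ k)|
  <= 32 * N%:R.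
Proof.
case: N => [|N]; first by rewrite big_geq// /psi_rem psi0 subrr mul0r addr0 normr0 mulr0.
set F := fun k => psi (N.+1 %/ k) - N.+1%:R / k%:R + (gam + 1).
have := @tatuzawa_iseki R N.+1 F isT.
rewrite {2}/F divn1 divr1 => e.
have {e} h : `|(psi N.+1 - N.+1%:R + (gam + 1)) * ln_ N.+1
     + \sum_(1 <= m < N.+2) mangoldt m * F m| <= 12 * N.+1%:R.
  rewrite -e; apply: le_trans (ler_norm_sum _ _ _) _.
  apply: (@le_trans _ _ (\sum_(1 <= d < N.+2)
      3 * ((ln_ N.+1 - ln_ d) + (ln_ N.+1 - ln_ d) ^+ 2))).
    rewrite big_nat [leRHS]big_nat; apply: ler_sum => d dN.
    rewrite normrM -[leRHS]mul1r; apply: ler_pM => //.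
      exact: mobius_norm_le1.
    have l0 : 0 <= ln_ N.+1 - ln_ d by rewrite subr_ge0 lnn_le//; case/andP: dN.
    rewrite normrM ger0_norm//.
    have := ler_wpM2l l0 (sum_selberg_weight_bound dN); rewrite /F; lra.
  rewrite -mulr_sumr big_split/=.
  have := @sum_ln_div R N.+1 isT; have := @sum_ln_div_sqr R N.+1 isT; lra.
have n1 : 1 <= N.+1%:R :> R by rewrite ler1n.
have g0 := euler_gamma_ge0; have g1 := euler_gamma_le1.
set S := \sum_(1 <= k < _) _.
have h1 : S <= \sum_(1 <= m < N.+2) mangoldt m * F m.
  rewrite /S big_nat [leRHS]big_nat; apply: ler_sum => k /andP[k0 _].
  apply: ler_wpM2l; first exact: mangoldt_ge0.
  by have [] := divn_bounds N.+1 k0; rewrite /psi_rem /F; lra.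
have h2 : \sum_(1 <= m < N.+2) mangoldt m * F m <= S + 2 * psi N.+1.
  rewrite psiE mulr_sumr -big_split/=.
  rewrite big_nat [leRHS]big_nat; apply: ler_sum => k /andP[k0 _].
  rewrite [2 * _]mulrC -mulrDr; apply: ler_wpM2l; first exact: mangoldt_ge0.
  by have [] := divn_bounds N.+1 k0; rewrite /psi_rem /F; lra.
have := psi_le_mul N.+1.
have : 0 <= (gam + 1) * ln_ N.+1 <= 2 * N.+1%:R.
  rewrite mulr_ge0 ?lnn_ge0//=; last by lra.
  by apply: ler_pM; rewrite ?lnn_ge0//; [lra|lra|exact/ltW/lnn_lt].
move: h; rewrite !ler_norml /psi_rem => /andP[a1 a2] /andP[a3 a4] a5.
by apply/andP; split; lra.
Qed.

Lemma psi_selberg N :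
  `|psi N * ln_ N + \sum_(1 <= k < N.+1) mangoldt k * psi (N %/ k) - 2 * N%:R * ln_ N|
  <= 33 * N%:R.
Proof.
have := psi_rem_selberg N.
have -> : \sum_(1 <= k < N.+1) mangoldt k * psi_rem (N %/ k) =
   \sum_(1 <= k < N.+1) mangoldt k * psi (N %/ k) - lnfact R N.
  by rewrite -sum_mangoldt_div -sumrB; apply: eq_bigr => k _; rewrite -mulrBr.
have := lnfact_le_mul N; have := @lnfact_ge R N.
rewrite !ler_norml /psi_rem => h1 h2 /andP[h3 h4]; apply/andP; split; lra.
Qed.

Lemma sum_mangoldt_ln_div N : \sum_(1 <= n < N.+1) mangoldt n * (ln_ N - ln_ n) <= 9 * N%:R.
Proof.
elim: N => [|N ih]; first by rewrite big_geq// mulr0.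
rewrite big_nat_recr//= subrr mulr0 addr0.
have -> : \sum_(1 <= n < N.+1) mangoldt n * (ln_ N.+1 - ln_ n) =
   \sum_(1 <= n < N.+1) mangoldt n * (ln_ N - ln_ n) + psi N * (ln_ N.+1 - ln_ N).
  rewrite psiE mulr_suml -big_split/=; apply: eq_bigr => n _; ring.
rewrite -[N.+1%:R]natr1 [9 * _]mulrDr mulr1; apply: lerD => //.
case: N {ih} => [|N]; first by rewrite psi0 mul0r.
have n0 : 0 < N.+1%:R :> R by rewrite ltr0n.
have -> : 9 = 9 * N.+1%:R * N.+1%:R^-1 :> R by rewrite -mulrA mulfV ?mulr1// gt_eqF.
apply: ler_pM; rewrite ?psi_ge0 ?psi_le_mul//; last exact: lnnS_le.
by rewrite subr_ge0 lnn_le.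
Qed.

(** Selberg's function Lambda_2, the Dirichlet convolution of mu and log^2; by the symmetry formula
    its mean value is 2 log n. *)
Definition mangoldt2 n : R :=
  mangoldt n * ln_ n + \sum_(1 <= m < n.+1 | (m %| n)%N) mangoldt m * mangoldt (n %/ m).

Lemma sum_mangoldt2_mul N (g : nat -> R) : \sum_(1 <= n < N.+1) mangoldt2 n * g n =
  \sum_(1 <= n < N.+1) mangoldt n * ln_ n * g n +
  \sum_(1 <= n < N.+1) mangoldt n * \sum_(1 <= m < (N %/ n).+1) mangoldt m * g (n * m)%N.
Proof.
have -> : \sum_(1 <= n < N.+1) mangoldt n * \sum_(1 <= m < (N %/ n).+1) mangoldt m * g (n * m)%N =
   \sum_(1 <= n < N.+1) \sum_(1 <= m < n.+1 | (m %| n)%N) mangoldt m * mangoldt (n %/ m) * g n.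
  under [LHS]eq_bigr do rewrite mulr_sumr.
  rewrite (sum_divisor_pairs N (fun n m => mangoldt n * (mangoldt m * g (n * m)%N))).
  apply: eq_bigr => n _; apply: eq_bigr => m mn.
  by rewrite mulrA [(m * _)%N]mulnC divnK.
rewrite -big_split/=; apply: eq_bigr => n _.
by rewrite /mangoldt2 mulrDl; congr (_ + _); rewrite mulr_suml.
Qed.

Lemma sum_mangoldt2 N : `|\sum_(1 <= n < N.+1) (mangoldt2 n - 2 * ln_ n)| <= 44 * N%:R.
Proof.
rewrite sumrB -mulr_sumr.
have -> : \sum_(1 <= n < N.+1) mangoldt2 n = \sum_(1 <= n < N.+1) mangoldt n * ln_ n +
    \sum_(1 <= k < N.+1) mangoldt k * psi (N %/ k).
  transitivity (\sum_(1 <= n < N.+1) mangoldt2 n * 1).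
    by apply: eq_bigr => n _; rewrite mulr1.
  rewrite (sum_mangoldt2_mul N (fun=> 1)); congr (_ + _); apply: eq_bigr => n _.
    by rewrite mulr1.
  by rewrite psiE; congr (_ * _); apply: eq_bigr => m _; rewrite mulr1.
rewrite -ln_fact -/(lnfact R N).
have := sum_mangoldt_ln_div N.
have -> : \sum_(1 <= n < N.+1) mangoldt n * (ln_ N - ln_ n) =
   psi N * ln_ N - \sum_(1 <= n < N.+1) mangoldt n * ln_ n.
  by rewrite psiE mulr_suml -sumrB; apply: eq_bigr => n _; rewrite mulrBr.
have : \sum_(1 <= n < N.+1) mangoldt n * ln_ n <= psi N * ln_ N.
  rewrite psiE mulr_suml big_nat [leRHS]big_nat; apply: ler_sum => n /andP[_ nN].
  by apply: ler_wpM2l; rewrite ?mangoldt_ge0// lnn_le.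
have := psi_selberg N; have := lnfact_le_mul N; have := @lnfact_ge R N.
rewrite !ler_norml => h1 h2 /andP[h3 h4] h5 h6; apply/andP; split; lra.
Qed.

(** Summation by parts, then a second one that turns the sum of n (h(n) - h(n+1)) back into the sum
    of h. The majorant h of the variation of g is there because the g of interest, |r(N / n)|, need
    not be monotone. *)
Lemma abel_bound (a g h : nat -> R) (C : R) N :
  (forall n, (0 < n)%N -> `|\sum_(1 <= k < n.+1) a k| <= C * n%:R) ->
  (forall n, (0 < n < N)%N -> `|g n - g n.+1| <= h n - h n.+1) -> (0 < N)%N ->
  `|\sum_(1 <= n < N.+1) a n * g n - (\sum_(1 <= n < N.+1) a n) * g N|
    <= C * (\sum_(1 <= n < N.+1) h n - N%:R * h N).
Proof.
move=> hA; elim: N => // -[|N] ih hg _.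
  by rewrite !big_nat1 mul1r !subrr normr0 mulr0.
rewrite big_nat_recr//= [in X in _ - X]big_nat_recr//= [in leRHS]big_nat_recr//=.
have := ih _ isT; set S := \sum_(1 <= n < _) _; set A := \sum_(1 <= n < _) _.
set H := \sum_(1 <= n < _) _ => {}ih.
have -> : S + a N.+2 * g N.+2 - (A + a N.+2) * g N.+2 =
   (S - A * g N.+1) + A * (g N.+1 - g N.+2) by ring.
apply: le_trans (ler_normD _ _) _.
have -> : C * (H + h N.+2 - N.+2%:R * h N.+2) =
  C * (H - N.+1%:R * h N.+1) + C * N.+1%:R * (h N.+1 - h N.+2).
  by rewrite -[N.+2%:R]natr1; ring.
apply: lerD; first by apply: ih => n /andP[n0 nN]; apply: hg; rewrite n0 ltnW.
rewrite normrM; apply: ler_pM => //; first exact: hA.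
by apply: hg; rewrite /= ltnSn.
Qed.

(** From log N times Selberg's formula at N, subtract Lambda(n) times the formula at N / n, summed
    over n: the terms log N Lambda(n) r(N / n) cancel. Lambda log and Lambda convolved with itself
    remain with opposite signs, and absolute values merge them into Lambda_2. *)
Lemma psi_rem_selberg_iter N :
  `|psi_rem N| * ln_ N ^+ 2 <=
  \sum_(1 <= n < N.+1) mangoldt2 n * `|psi_rem (N %/ n)| + 72 * N%:R * ln_ N.
Proof.
have [->|N0] := posnP N.
  by rewrite /psi_rem psi0 subrr normr0 mul0r big_geq// !(mulr0, mul0r) addr0.
(* Selberg's formula at M = [N %/ n], with log(N / n) in place of log M. The difference e of these
   satisfies e M <= 1 and costs at most 8, so 40 M = 32 M + 8 M covers it. *)
have step : `|\sum_(1 <= n < N.+1) mangoldt n * (psi_rem (N %/ n) * (ln_ N - ln_ n)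
    + \sum_(1 <= m < (N %/ n).+1) mangoldt m * psi_rem (N %/ n %/ m))| <= 40 * N%:R * ln_ N.
  apply: le_trans (ler_norm_sum _ _ _) _.
  apply: (@le_trans _ _ (\sum_(1 <= n < N.+1) 40 * (mangoldt n * (N %/ n)%:R))); last first.
    by rewrite -mulr_sumr sum_mangoldt_div -mulrA ler_wpM2l// lnfact_le_mul.
  rewrite big_nat [leRHS]big_nat; apply: ler_sum => n /andP[n0]; rewrite ltnS => nN.
  rewrite normrM ger0_norm ?mangoldt_ge0// mulrCA; apply: ler_wpM2l; first exact: mangoldt_ge0.
  have M0 : (0 < N %/ n)%N by rewrite divn_gt0.
  have := psi_rem_selberg (N %/ n); have := psi_rem_le (N %/ n).
  have := @lnn_divn N n; rewrite n0 nN => /(_ isT).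
  have [_] := divn_bounds N n0.
  have n0' : 0 < n%:R :> R by rewrite ltr0n.
  have M0' : 0 < (N %/ n)%:R :> R by rewrite ltr0n.
  have x0 : 0 < N%:R / n%:R :> R by rewrite divr_gt0// ltr0n.
  have := ln_sub_le M0' x0; rewrite ln_div ?posrE ?ltr0n//.
  rewrite -/(ln_ N) -/(ln_ n) -/(ln_ (N %/ n)%N).
  set S := \sum_(1 <= m < _) _; set M := (N %/ n)%N in M0 M0' *.
  set x := N%:R / n%:R => h1 h2 h3 h4 h5.
  have M1 : 1 <= M%:R :> R by rewrite ler1n.
  set e := ln_ N - ln_ n - ln_ M in h1.
  have e0 : 0 <= e by rewrite /e; lra.
  have eM : e * M%:R <= 1.
    by have := ler_wpM2r (ltW M0') h1; rewrite [(x / _ - 1) * _]mulrBl divfK ?gt_eqF//; lra.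
  have -> : psi_rem M * (ln_ N - ln_ n) + S = (psi_rem M * ln_ M + S) + psi_rem M * e.
    by rewrite /e; ring.
  apply: le_trans (ler_normD _ _) _.
  have : `|psi_rem M * e| <= 8 * (M%:R * e).
    by rewrite normrM (ger0_norm e0) mulrA ler_wpM2r.
  by move: h5; rewrite [M%:R * e]mulrC; lra.
have main := psi_rem_selberg N.
have l0 := @lnn_ge0 R N.
have e1 : \sum_(1 <= n < N.+1) mangoldt n * (psi_rem (N %/ n) * (ln_ N - ln_ n)
    + \sum_(1 <= m < (N %/ n).+1) mangoldt m * psi_rem (N %/ n %/ m)) =
  ln_ N * (\sum_(1 <= k < N.+1) mangoldt k * psi_rem (N %/ k))
  - \sum_(1 <= n < N.+1) mangoldt n * ln_ n * psi_rem (N %/ n)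
  + \sum_(1 <= n < N.+1) mangoldt n * \sum_(1 <= m < (N %/ n).+1) mangoldt m * psi_rem (N %/ (n * m)).
  rewrite mulr_sumr -sumrB -big_split/=; apply: eq_bigr => n _.
  under [in RHS]eq_bigr do rewrite divnMA.
  by ring.
have e : psi_rem N * ln_ N ^+ 2 =
   ln_ N * (psi_rem N * ln_ N + \sum_(1 <= k < N.+1) mangoldt k * psi_rem (N %/ k))
   - \sum_(1 <= n < N.+1) mangoldt n * (psi_rem (N %/ n) * (ln_ N - ln_ n)
    + \sum_(1 <= m < (N %/ n).+1) mangoldt m * psi_rem (N %/ n %/ m))
   + (\sum_(1 <= n < N.+1) mangoldt n * \sum_(1 <= m < (N %/ n).+1) mangoldt m * psi_rem (N %/ (n * m))
      - \sum_(1 <= n < N.+1) mangoldt n * ln_ n * psi_rem (N %/ n)).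
  by rewrite e1; ring.
have -> : `|psi_rem N| * ln_ N ^+ 2 = `|psi_rem N * ln_ N ^+ 2|.
  by rewrite normrM (ger0_norm (exprn_ge0 2 l0)).
rewrite e sum_mangoldt2_mul.
apply: le_trans (ler_normD _ _) _; rewrite addrC; apply: lerD.
  apply: le_trans (ler_normB _ _) _; rewrite addrC; apply: lerD.
    apply: le_trans (ler_norm_sum _ _ _) _; apply: ler_sum => n _.
    by rewrite normrM ger0_norm// mulr_ge0 ?mangoldt_ge0 ?lnn_ge0.
  apply: le_trans (ler_norm_sum _ _ _) _; apply: ler_sum => n _.
  rewrite normrM ger0_norm ?mangoldt_ge0//; apply: ler_wpM2l; first exact: mangoldt_ge0.
  apply: le_trans (ler_norm_sum _ _ _) _; apply: ler_sum => m _.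
  by rewrite normrM ger0_norm ?mangoldt_ge0.
apply: le_trans (ler_normB _ _) _.
rewrite normrM (ger0_norm l0); have := ler_wpM2l l0 main; lra.
Qed.

(** As Lambda_2 has mean 2 log n, summation by parts exchanges the two. The variation of n -> |r(N /
    n)| is at most that of the nonincreasing function psi(N / n) + N / n, whose sum is O(N log
    N). *)
Theorem psi_rem_selberg_ineq N : (0 < N)%N ->
  `|psi_rem N| * ln_ N ^+ 2 <=
  2 * \sum_(1 <= n < N.+1) ln_ n * `|psi_rem (N %/ n)| + 160 * N%:R * (1 + ln_ N).
Proof.
move=> N0; apply: le_trans (psi_rem_selberg_iter N) _.
have := @abel_bound (fun n => mangoldt2 n - 2 * ln_ n) (fun n => `|psi_rem (N %/ n)|)
  (fun n => psi (N %/ n) + (N %/ n)%:R) 44 N (fun n _ => sum_mangoldt2 n).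
rewrite N0 divnn N0 psi1 add0r mulr1 => H.
have {}H := H _ isT.
have : `|psi_rem 1| = 1 by rewrite /psi_rem psi1 sub0r normrN normr1.
move: H; set g := fun n => `|psi_rem (N %/ n)|.
set h := fun n => psi (N %/ n) + (N %/ n)%:R.
have -> : \sum_(1 <= n < N.+1) (mangoldt2 n - 2 * ln_ n) * g n =
   \sum_(1 <= n < N.+1) mangoldt2 n * g n - 2 * \sum_(1 <= n < N.+1) ln_ n * g n.
  by rewrite mulr_sumr -sumrB; apply: eq_bigr => n _; rewrite mulrBl mulrA.
have -> : \sum_(1 <= n < N.+1) h n = lnfact R N + \sum_(1 <= n < N.+1) (N %/ n)%:R.
  by rewrite big_split/= sum_psi_div.
have hs : \sum_(1 <= n < N.+1) (N %/ n)%:R <= N%:R * (1 + ln_ N) :> R.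
  apply: (@le_trans _ _ (N%:R * harm R N)).
    rewrite /harm mulr_sumr big_nat [leRHS]big_nat; apply: ler_sum => n /andP[n0 _].
    by have [] := divn_bounds N n0.
  by apply: ler_wpM2l => //; exact: harm_le.
move=> H e; have := sum_mangoldt2 N; move: H; rewrite {}e => H.
have {}H := H _; move: H; set A := \sum_(1 <= n < _) (mangoldt2 n - _).
set S := \sum_(1 <= n < _) mangoldt2 n * _; set T := \sum_(1 <= n < _) ln_ n * _.
move=> H; rewrite mulr1 in H; move: H => H hA.
have lf := lnfact_le_mul N.
have {}H : `|S - 2 * T - A| <= 44 * (lnfact R N + \sum_(1 <= n < N.+1) (N %/ n)%:R - N%:R).
  apply: H => n /andP[n0 nN].
  have le_div : (N %/ n.+1 <= N %/ n)%N by apply: leq_div2l.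
  apply: le_trans (ler_dist_dist _ _) _; rewrite /psi_rem.
  have := psi_le (R := R) le_div; have : (N %/ n.+1)%:R <= (N %/ n)%:R :> R by rewrite ler_nat.
  by rewrite ler_norml => u1 u2; apply/andP; split; lra.
have l0 := @lnn_ge0 R N.
have N1 : 1 <= N%:R :> R by rewrite ler1n.
have nl : 0 <= N%:R * ln_ N by rewrite mulr_ge0.
move: H hA; rewrite !ler_norml => /andP[_ H] /andP[_ hA]; lra.
Qed.

End Selberg.
Arguments psi_rem R n : clear implicits.

(** * The prime number theorem *)

Section PrimeNumberTheorem.
Context {R : realType}.
Implicit Types (n N m : nat).
Local Notation ln_ := (lnn R).
Local Notation psi := (psi R).
Local Notation mangoldt := (mangoldt R).
Local Notation psi_rem := (psi_rem R).

Lemma exists_nat_gt (x : R) : exists2 n, (0 < n)%N & x < n%:R.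
Proof. by exists (Num.truncn x).+1 => //; exact: truncnS_gt. Qed.

Lemma exists_nat_lnn_gt (x : R) : exists2 n, (1 < n)%N & forall m, (n <= m)%N -> x < ln_ m.
Proof.
have [n n0 xn] := exists_nat_gt (expR x).
exists n.+1 => [|m nm]; first by rewrite ltnS.
have m0 : (0 < m)%N by lia.
rewrite -(expRK x) ltr_ln ?posrE ?expR_gt0 ?ltr0n//.
by apply: lt_le_trans xn _; rewrite ler_nat ltnW.
Qed.

Lemma lnn_le_linear (eta : R) : 0 < eta ->
  exists2 D : R, 0 <= D & forall n, ln_ n <= eta * n%:R + D.
Proof.
move=> eta0; exists `|ln eta| => // -[|n]; first by rewrite mulr0 add0r {1}/lnn ln0.
have n0 : 0 < n.+1%:R :> R by rewrite ltr0n.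
have := @ln_sublinear R (eta * n.+1%:R) (mulr_gt0 eta0 n0).
rewrite lnM ?posrE//; have := ler_norm (- ln eta); rewrite normrN /lnn; lra.
Qed.

(** Subtract the symmetry formula at a from the one at b: the sums over k increase, so psi grows by
    at most about 2 (b - a). It also grows by at least 0, so r = psi - id moves by at most about b -
    a either way. The error is 33 (a + b) <= 99 a, plus 4 a for log b against log a. *)
Lemma psi_rem_lipschitz a b : (0 < a <= b)%N -> (b <= 2 * a)%N ->
  ln_ a * `|psi_rem b - psi_rem a| <= (b%:R - a%:R) * ln_ a + 103 * a%:R.
Proof.
move=> /andP[a0 ab] b2a.
have a0' : 0 < a%:R :> R by rewrite ltr0n.
have b0' : 0 < b%:R :> R by rewrite ltr0n (leq_trans a0).
have ab' : a%:R <= b%:R :> R by rewrite ler_nat.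
have b2a' : b%:R <= 2 * a%:R :> R by rewrite -natrM ler_nat.
have l0 := @lnn_ge0 R a; have lab : ln_ a <= ln_ b by apply: lnn_le.
have pab := psi_le (R := R) ab.
have := psi_selberg (R := R) a; have := psi_selberg (R := R) b.
set A := \sum_(1 <= k < b.+1) _; set B := \sum_(1 <= k < a.+1) _.
have BA : B <= A.
  rewrite /A (@big_cat_nat _ _ _ a.+1)//= -[B]addr0; apply: lerD; last first.
    by apply: sumr_ge0 => k _; rewrite mulr_ge0 ?mangoldt_ge0 ?psi_ge0.
  apply: ler_sum => k _; apply: ler_wpM2l; first exact: mangoldt_ge0.
  by apply: psi_le; apply: leq_div2r.
have e : b%:R * (ln_ b - ln_ a) <= 2 * a%:R.
  have : ln_ b - ln_ a <= 1.
    have := ln_sub_le a0' b0'.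
    have : b%:R / a%:R <= 2 :> R by rewrite ler_pdivrMr.
    rewrite /lnn; lra.
  move=> h; apply: le_trans b2a'; rewrite -[leRHS]mulr1.
  by apply: ler_wpM2l => //; exact: ltW.
have h : (psi b - psi a) * ln_ a <= 2 * (b%:R - a%:R) * ln_ a + 103 * a%:R ->
  ln_ a * `|psi_rem b - psi_rem a| <= (b%:R - a%:R) * ln_ a + 103 * a%:R.
  move=> H; rewrite -[X in X * _](ger0_norm l0) -normrM ler_norml /psi_rem.
  have : 0 <= (psi b - psi a) * ln_ a by rewrite mulr_ge0// subr_ge0.
  by move=> H'; apply/andP; split; lra.
have : psi b * ln_ a <= psi b * ln_ b by apply: ler_wpM2l; rewrite ?psi_ge0.
rewrite !ler_norml => h1 /andP[h2 h3] /andP[h4 h5]; apply: h; lra.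
Qed.

(** Mertens: N times the sum differs from log N! = sum_n Lambda(n) [N / n] by at most psi(N) <= 9
    N. *)
Lemma sum_mangoldt_over N : (0 < N)%N ->
  ln_ N - 1 <= \sum_(1 <= n < N.+1) mangoldt n / n%:R <= ln_ N + 9.
Proof.
move=> N0; have n0 : 0 < N%:R :> R by rewrite ltr0n.
set S := \sum_(_ <= n < _) _.
have e : N%:R * S = \sum_(1 <= n < N.+1) mangoldt n * (N%:R / n%:R).
  by rewrite mulr_sumr; apply: eq_bigr => n _; ring.
have h1 : lnfact R N <= N%:R * S.
  rewrite e -sum_mangoldt_div big_nat [leRHS]big_nat; apply: ler_sum => n /andP[n1 _].
  apply: ler_wpM2l; first exact: mangoldt_ge0.
  by have [] := @divn_bounds R N n n1.
have h2 : N%:R * S <= lnfact R N + psi N.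
  rewrite e -sum_mangoldt_div psiE -big_split/=.
  rewrite big_nat [leRHS]big_nat; apply: ler_sum => n /andP[n1 _].
  rewrite -[X in _ <= _ + X]mulr1 -mulrDr; apply: ler_wpM2l; first exact: mangoldt_ge0.
  by have [_ /ltW] := @divn_bounds R N n n1.
have := @lnfact_ge R N; have := @lnfact_le_mul R N; have := @psi_le_mul R N => h3 h4 h5.
by apply/andP; split; rewrite -(ler_pM2l n0); lra.
Qed.

Definition psi_rem_weighted n : R := psi_rem n * (n%:R^-1 - n.+1%:R^-1).

(** The summand is r(n) / (n (n+1)). Partial summation yields Mertens's sum minus psi(M) / (M+1) and
    minus H_(M+1) - 1, where the logarithms cancel. *)
Lemma sum_psi_rem_weighted N : `|\sum_(1 <= n < N.+1) psi_rem_weighted n| <= 11.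
Proof.
case: N => [|N]; first by rewrite big_geq// normr0.
have e M : \sum_(1 <= n < M.+1) psi_rem_weighted n =
    \sum_(1 <= n < M.+1) mangoldt n / n%:R - psi M * M.+1%:R^-1 - (harm R M.+1 - 1).
  elim: M => [|M ih].
    by rewrite !big_geq// psi0 harmS harm0 invr1; ring.
  rewrite !(@big_nat_recr _ _ _ M.+1)//= ih /psi_rem_weighted /psi_rem /mangoldt /= (harmS M.+1).
  have : M.+1%:R * M.+1%:R^-1 = 1 :> R by rewrite mulfV.
  have : M.+2%:R * M.+2%:R^-1 = 1 :> R by rewrite mulfV.
  rewrite -[in X in X * _ = 1 -> _]natr1.
  set x := M.+1%:R; set i := x^-1; set j := M.+2%:R^-1 => h1 h2.
  have : x * i - (x * j + j) = 0 by rewrite h2 -h1; ring.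
  lra.
rewrite e; have := @sum_mangoldt_over N.+1 isT; have := @harm_le R N.+2 isT.
have := @harm_ge R N.+2; have := @lnnS_le R N.+1 isT.
have := @lnn_le R N.+1 N.+3 (leq_addl 2 _).
have : N.+1%:R^-1 <= 1 :> R by rewrite invf_le1// ler1n.
have : 0 <= psi N.+1 * N.+2%:R^-1 by rewrite mulr_ge0// psi_ge0.
have : psi N.+1 * N.+2%:R^-1 <= 9.
  rewrite ler_pdivrMr//; apply: le_trans (psi_le_mul _) _.
  by rewrite ler_wpM2l// ler_nat.
move: (psi N.+1 * N.+2%:R^-1) (N.+1%:R^-1 : R) => p i h1 h2 h3 h4 h5 h6 h7 /andP[h8 h9].
rewrite ler_norml; apply/andP; split; lra.
Qed.

Lemma psi_rem_step n : `|psi_rem n.+1 - psi_rem n| <= 1 + ln_ n.+1.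
Proof.
have := psi_leS (R := R) n; have := psiS_le (R := R) n; have := @lnn_ge0 R n.+1.
rewrite /psi_rem -[n.+1%:R]natr1 ler_norml => h1 h2 h3; apply/andP; split; lra.
Qed.

(** If |r(m)| > d m on all of [y, K y[, then r keeps its sign there, since steps of at most 1 +
    log(m+1) <= d m cannot cross the gap. The sum of r(m) / (m (m+1)) over this range is then at
    least d log(K / 2) in absolute value, against its boundedness. *)
Lemma psi_rem_small_value (d : R) : 0 < d -> exists K Y : nat, (1 < K)%N /\ (0 < Y)%N /\
  forall y, (Y <= y)%N -> exists2 m, (y <= m < K * y)%N & `|psi_rem m| <= d * m%:R.
Proof.
move=> d0.
(* A difference of two partial sums bounded by 11 is at most 22; log 2 pays for y + 1 <= 2 y in the
   lower bound of the harmonic sum. *)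
have [K K1 hK] := exists_nat_lnn_gt (22 / d + ln_ 2).
have d2 : 0 < d / 2 by rewrite divr_gt0.
have [D D0 hD] := lnn_le_linear d2.
have [Y Y0 hY] := exists_nat_gt ((d / 2 + D + 1) / (d / 2)).
exists K, Y; split=> //; split=> // y Yy; apply: contrapT => hn.
have {}hn m : (y <= m < K * y)%N -> d * m%:R < `|psi_rem m|.
  by move=> hm; rewrite ltNge; apply/negP => h; apply: hn; exists m.
have y0 : (0 < y)%N by lia.
have yK : (y < K * y)%N by rewrite ltn_Pmull.
have hstep m : (y <= m)%N -> 1 + ln_ m.+1 <= d * m%:R.
  move=> ym; have := hD m.+1; rewrite -[m.+1%:R]natr1.
  have : (d / 2 + D + 1) / (d / 2) < m%:R.
    by apply: lt_le_trans hY _; rewrite ler_nat (leq_trans Yy).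
  rewrite ltr_pdivrMr//; lra.
(* [s] is the sign of r(y), so that both signs are treated at once. *)
suff H (s : R) : `|s| = 1 -> d * y%:R < s * psi_rem y -> False.
  have := hn y; rewrite leqnn yK => /(_ isT).
  rewrite lter_normr => /orP[h|h].
    by apply: (H 1); rewrite ?normr1// mul1r.
  by apply: (H (-1)); rewrite ?normrN1// mulN1r.
move=> s1 hy.
have hs k : (y + k < K * y)%N -> d * (y + k)%:R < s * psi_rem (y + k).
  elim: k => [|k ih]; first by rewrite addn0.
  rewrite addnS => hk; have := ih (ltnW hk).
  have := hn (y + k).+1; rewrite hk (leqW (leq_addr _ _)) => /(_ isT).
  have := psi_rem_step (y + k); have := hstep _ (leq_addr k y).
  have : 0 <= d * (y + k)%:R by rewrite mulr_ge0// ltW.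
  have dS : d * (y + k).+1%:R = d * (y + k)%:R + d by rewrite -natr1; ring.
  set z := _%:R in dS *.
  rewrite dS => h0 h1 h2.
  have s2 : `|s * psi_rem (y + k).+1| = `|psi_rem (y + k).+1| by rewrite normrM s1 mul1r.
  have : `|s * (psi_rem (y + k).+1 - psi_rem (y + k))| <= 1 + ln_ (y + k).+1.
    by rewrite normrM s1 mul1r.
  rewrite -s2 mulrBr ler_norml lter_normr => /andP[h3 h4] /orP[|]; lra.
have hsum : \sum_(y <= m < K * y) d * m.+1%:R^-1 <= s * \sum_(y <= m < K * y) psi_rem_weighted m.
  rewrite mulr_sumr big_nat [leRHS]big_nat; apply: ler_sum => m /andP[ym mK].
  have := hs (m - y)%N; rewrite subnKC// mK => /(_ isT) /ltW h.
  have m0 : 0 < m%:R :> R by rewrite ltr0n; lia.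
  have -> : d * m.+1%:R^-1 = d * m%:R * (m%:R^-1 - m.+1%:R^-1).
    by rewrite -natr1; field; rewrite gt_eqF ?ltr_wpDr//= gt_eqF.
  rewrite /psi_rem_weighted mulrA ler_wpM2r// subr_ge0 lef_pV2 ?posrE ?ler_nat//.
have hlow : d * (ln_ (K * y) - ln_ (2 * y)) <= \sum_(y <= m < K * y) d * m.+1%:R^-1.
  rewrite -mulr_sumr; apply: ler_wpM2l; first exact: ltW.
  have -> : \sum_(y <= m < K * y) m.+1%:R^-1 = harm R (K * y) - harm R y.
    rewrite /harm [in X in _ = X - _](@big_cat_nat _ _ _ y.+1)//=; last first.
      by rewrite ltnS ltnW.
    by rewrite addrAC subrr add0r big_add1.
  have := @harm_sub_lnnS_ndecr R y (K * y - y); rewrite subnKC ?(ltnW yK)//.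
  have : ln_ y.+1 <= ln_ (2 * y) by apply: lnn_le; lia.
  have := @lnn_le R (K * y) (K * y).+1 (leqnSn _); lra.
have : s * \sum_(y <= m < K * y) psi_rem_weighted m <= 22.
  apply: le_trans (ler_norm _) _; rewrite normrM s1 mul1r.
  have -> : \sum_(y <= m < K * y) psi_rem_weighted m =
     \sum_(1 <= m < (K * y).-1.+1) psi_rem_weighted m - \sum_(1 <= m < y.-1.+1) psi_rem_weighted m.
    rewrite !prednK//; last by lia.
    by rewrite (@big_cat_nat _ _ _ y 1 (K * y))//= ?(ltnW yK)// addrAC subrr add0r.
  apply: le_trans (ler_normB _ _) _.
  have := sum_psi_rem_weighted (K * y).-1; have := sum_psi_rem_weighted y.-1; lra.
have := hK K (leqnn _); rewrite -ltrBrDr ltr_pdivrMr//.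
move: hlow; rewrite !lnnM//; last by lia.
lra.
Qed.

(** A value |r(m)| <= d m spreads to [m, m + d m]: there r moves by at most d m + 103 m / log m <= 2
    d m, once log m > 103 / d. *)
Lemma psi_rem_small_interval (d : R) : 0 < d < 1 -> exists K Y : nat,
  (1 < K)%N /\ (0 < Y)%N /\
  forall y, (Y <= y)%N -> exists2 m, (y <= m < K * y)%N &
    forall t, (m <= t)%N -> t%:R <= m%:R + d * m%:R -> `|psi_rem t| <= 3 * d * t%:R.
Proof.
move=> /andP[d0 d1].
have [K [Y [K1 [Y0 hK]]]] := psi_rem_small_value d0.
have [Z Z1 hZ] := exists_nat_lnn_gt (103 / d).
exists K, (maxn Y Z); split=> //; split; first by lia.
move=> y hy; have [|m ym hm] := hK y; first by lia.
exists m => // t mt ht.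
have m0 : (0 < m)%N by lia.
have m0' : 0 < m%:R :> R by rewrite ltr0n.
have t2m : (t <= 2 * m)%N by rewrite -(ler_nat R) natrM; nra.
have := psi_rem_lipschitz (a := m) (b := t); rewrite m0 mt => /(_ isT t2m).
have lm : 103 / d < ln_ m by apply: hZ; lia.
have l0 : 0 < ln_ m by apply: le_lt_trans lm; rewrite divr_ge0// ltW.
move: lm; rewrite ltr_pdivrMr// => lm h.
have {}h : `|psi_rem t - psi_rem m| <= 2 * d * m%:R.
  rewrite -(ler_pM2l l0); apply: le_trans h _.
  have : 103 * m%:R <= ln_ m * d * m%:R by rewrite ler_wpM2r// ltW.
  have : (t%:R - m%:R) * ln_ m <= d * m%:R * ln_ m by rewrite ler_pM2r//; lra.
  lra.
have : d * m%:R <= d * t%:R by rewrite ler_pM2l// ler_nat.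
have := ler_normD (psi_rem t - psi_rem m) (psi_rem m); rewrite subrK; lra.
Qed.

(** The n whose [N %/ n] lies in an interval [m, m'] of small remainder, m' about (1 + d) m, fill
    ]M0, M1]. Their harmonic sum is at least (M1 - M0) m / N >= 1 - m / N - m / (m' + 1), where m /
    (m' + 1) <= 1 - d / 2 and m / N <= d / 4. *)
Lemma good_block (d : R) : 0 < d < 1 -> exists q Y : nat, (1 < q)%N /\ (0 < Y)%N /\
  forall N a, (q <= a)%N -> (q * a * Y <= N)%N ->
  d / 4 <= \sum_(a <= n < q * a | `|psi_rem (N %/ n)| <= 3 * d * (N %/ n)%:R) n%:R^-1.
Proof.
move=> d01; have /andP[d0 d1] := d01.
have [K [Y [K1 [Y0 hK]]]] := psi_rem_small_interval d01.
have [k k0 hk] := exists_nat_gt (d^-1).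
(* As m <= 2 K r and m' + 1 <= 3 m, the factor 6 K ensures a <= M0; the factor k > 1 / d makes m / N
   <= d / 4. *)
set K' := (K * k)%N; exists (6 * K')%N, Y; split; first by rewrite /K'; nia.
split=> // N a qa aN.
set q := (6 * K')%N in qa aN *.
have q0 : (0 < q)%N by rewrite /q /K'; nia.
have q1 : (1 < q)%N by rewrite /q /K'; nia.
have a1 : (1 < a)%N by apply: leq_trans qa.
have a0 : (0 < a)%N by apply: ltnW.
have qa0 : (0 < q * a)%N by rewrite muln_gt0 q0.
set r := (N %/ (q * a))%N.
have Yr : (Y <= r)%N by rewrite leq_divRL// mulnC.
have [m /andP[rm mK] hm] := hK r.+1 (leqW Yr).
have m0 : (0 < m)%N by apply: leq_ltn_trans rm.
have m0' : 0 < m%:R :> R by rewrite ltr0n.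
set m' := Num.truncn (m%:R + d * m%:R).
have /andP[m'1 m'2] : (m'%:R : R) <= m%:R + d * m%:R < m'.+1%:R.
  by apply: truncn_itv; rewrite addr_ge0// mulr_ge0// ltW.
have mm' : (m <= m')%N.
  by rewrite truncn_ge_nat ?addr_ge0 ?mulr_ge0 ?(ltW d0)// lerDl mulr_ge0// ltW.
have m'2m : (m' <= 2 * m)%N.
  rewrite -(ler_nat R) natrM; apply: le_trans m'1 _; nra.
have r0 : (0 < r)%N by apply: leq_trans Yr.
have rN : (r * (q * a) <= N)%N by apply: leq_trunc_div.
have mKr : (m <= 2 * K * r)%N by nia.
have KK' : (K <= K')%N by rewrite /K' leq_pmulr.
have ham : (a * m'.+1 <= N)%N.
  apply: leq_trans rN; rewrite mulnA [(r * q)%N]mulnC mulnC; apply: leq_mul => //.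
  have h1 : (m'.+1 <= 3 * m)%N by lia.
  apply: leq_trans h1 _; rewrite /q; nia.
have N0 : (0 < N)%N by nia.
have N0' : 0 < N%:R :> R by rewrite ltr0n.
set M1 := (N %/ m)%N; set M0 := (N %/ m'.+1)%N.
have M1lt : (M1 < q * a)%N.
  rewrite ltn_divLR//; apply: leq_trans (ltn_ceil N qa0) _.
  by rewrite mulnC leq_mul2l rm orbT.
have aM0 : (a <= M0)%N by rewrite leq_divRL.
have M01 : (M0 <= M1)%N by apply: leq_div2l => //; exact: leqW.
have h1 : \sum_(M0.+1 <= n < M1.+1) n%:R^-1 <=
    \sum_(a <= n < q * a | `|psi_rem (N %/ n)| <= 3 * d * (N %/ n)%:R) n%:R^-1 :> R.
  rewrite big_nat [leRHS](@big_cat_nat _ _ _ M0.+1)//=; [|exact: leqW|exact: leq_ltn_trans M1lt].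
  rewrite -[leLHS]add0r; apply: lerD; first by rewrite sumr_ge0// => n _; rewrite invr_ge0.
  rewrite [leRHS](@big_cat_nat _ _ _ M1.+1)//=.
  rewrite -[leLHS]addr0; apply: lerD; last by rewrite sumr_ge0// => n _; rewrite invr_ge0.
  rewrite -big_nat [leRHS]big_mkcond/= big_nat [leRHS]big_nat.
  apply: ler_sum => n /andP[n1 n2].
  have n0 : (0 < n)%N by apply: leq_ltn_trans n1.
  rewrite hm//.
    by rewrite leq_divRL// mulnC -leq_divRL.
  apply: le_trans m'1; rewrite ler_nat -ltnS ltn_divLR// mulnC -ltn_divLR//.
apply: le_trans h1.
have h2 : (M1 - M0)%:R * (m%:R / N%:R) <= \sum_(M0.+1 <= n < M1.+1) n%:R^-1 :> R.
  rewrite mulr_natl -[X in _ *+ X](subSS M0 M1) -sumr_const_nat.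
  rewrite big_nat [leRHS]big_nat; apply: ler_sum => n /andP[n1 n2].
  have n0' : 0 < n%:R :> R by rewrite ltr0n (leq_ltn_trans _ n1).
  rewrite ler_pdivrMr// -ler_pdivrMl ?invr_gt0// invrK -natrM ler_nat.
  by rewrite -leq_divRL.
apply: le_trans h2; rewrite natrB//.
have [_ b1] := @divn_bounds R N m m0.
have [b0 _] := @divn_bounds R N m'.+1 isT.
rewrite -/M1 -/M0 in b1 b0.
apply: (@le_trans _ _ ((N%:R / m%:R - 1 - N%:R / m'.+1%:R) * (m%:R / N%:R))); last first.
  apply: ler_wpM2r; first by rewrite divr_ge0// ltW.
  by move: b0 b1; move: (N%:R / m'.+1%:R) (N%:R / m%:R) => u v; lra.
have -> : (N%:R / m%:R - 1 - N%:R / m'.+1%:R) * (m%:R / N%:R) =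
   1 - m%:R / N%:R - m%:R / m'.+1%:R :> R.
  rewrite -[m'.+1%:R]natr1; field.
  by rewrite !gt_eqF ?ltr_wpDl//.
have c1 : m%:R / m'.+1%:R <= 1 - d / 2 :> R.
  rewrite ler_pdivrMr//.
  have : (1 - d / 2) * (m%:R + d * m%:R) <= (1 - d / 2) * m'.+1%:R.
    by apply: ler_wpM2l; [lra|exact: ltW].
  apply: le_trans.
  have : 0 <= d * (1 - d) * m%:R by rewrite !mulr_ge0// ?ltW//; lra.
  lra.
have c2 : m%:R / N%:R <= d / 4 :> R.
  rewrite ler_pdivrMr//.
  have : 1 <= d * k%:R by move: hk; rewrite -[d^-1]mul1r ltr_pdivrMr// mulrC => /ltW.
  have : (4 * k * m <= N)%N.
    have h1 : (4 * k * m <= 4 * k * (2 * K * r))%N by rewrite leq_mul2l mKr orbT.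
    apply: leq_trans h1 _; apply: leq_trans rN.
    have -> : (4 * k * (2 * K * r) = 8 * (K' * r))%N by rewrite /K'; ring.
    have -> : (r * (q * a) = 6 * a * (K' * r))%N by rewrite /q; ring.
    by rewrite leq_mul2r; apply/orP; right; apply: (@leq_trans (6 * 2)) => //; rewrite leq_mul2l.
  rewrite -(ler_nat R) !natrM => h h'.
  have : d * (4 * k%:R * m%:R) <= d * N%:R by rewrite ler_pM2l.
  have : m%:R <= (d * k%:R) * m%:R by rewrite ler_peMl// ltW.
  lra.
move: c1 c2; move: (m%:R / m'.+1%:R) (m%:R / N%:R) => u v; lra.
Qed.

(** On the block [q^j, q^(j+1)[ log n is at least j l with l = log q, so the good n contribute at
    least j l d / 4. About J = log N / l blocks fit below N, and l (d / 4) J^2 / 2 = d (log N)^2 /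
    (8 l) explains the constant c. *)
Lemma good_log_sum (d : R) : 0 < d < 1 -> exists c : R, 0 < c /\
  exists D : R, 0 <= D /\ exists Y : nat, (0 < Y)%N /\ forall N, (Y <= N)%N ->
  c * ln_ N ^+ 2 - D * ln_ N <=
  \sum_(1 <= n < N.+1 | `|psi_rem (N %/ n)| <= 3 * d * (N %/ n)%:R) ln_ n / n%:R.
Proof.
move=> d01; have /andP[d0 d1] := d01.
have [q [Y [q1 [Y0 hq]]]] := good_block d01.
set l := ln_ q; have l0 : 0 < l by apply: lnn_gt0.
set y := ln_ Y; have y0 : 0 <= y by apply: lnn_ge0.
have q0 : (0 < q)%N by lia.
set c := d / (8 * l).
have c0 : 0 < c by rewrite divr_gt0// mulr_gt0.
exists c; split => //; exists (c * (2 * y + 3 * l)); split.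
  by apply: mulr_ge0; [exact: ltW|lra].
exists Y; split=> // N YN.
set J := trunc_log q (N %/ Y).
have NY0 : (0 < N %/ Y)%N by rewrite divn_gt0.
have hJ1 : (q ^ J * Y <= N)%N by rewrite -leq_divRL//; exact: trunc_logP.
have hJ2 : (N < q ^ J.+1 * Y)%N by rewrite -ltn_divLR//; exact: trunc_log_ltn.
have hJl : ln_ N <= J.+1%:R * l + y.
  rewrite -lnnX// -lnnM ?expn_gt0 ?q0//; apply: lnn_le; exact: ltnW.
have Nl : y <= ln_ N by apply: lnn_le.
(* The block [1, q[ is left out, since [good_block] asks for q <= a; the others give the factor 1 +
   ... + j. *)
have blocks j : (j < J)%N -> l * d / 4 * (j%:R * (j%:R + 1) / 2) <=
    \sum_(1 <= n < q ^ j.+1 | `|psi_rem (N %/ n)| <= 3 * d * (N %/ n)%:R) ln_ n / n%:R.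
  elim: j => [|j ih] jJ.
    rewrite !mul0r mulr0 sumr_ge0// => n _; by rewrite mulr_ge0 ?lnn_ge0// invr_ge0.
  have {}ih := ih (ltnW jJ).
  rewrite (@big_cat_nat _ _ _ (q ^ j.+1))//=; last 2 first.
  - by rewrite expn_gt0 q0.
  - by rewrite leq_exp2l.
  have := hq N (q ^ j.+1)%N; rewrite -expnS.
  have -> : (q <= q ^ j.+1)%N by rewrite -{1}(expn1 q) leq_exp2l.
  have -> : (q ^ j.+2 * Y <= N)%N.
    by apply: leq_trans hJ1; rewrite leq_mul2r leq_exp2l// jJ orbT.
  move=> /(_ isT isT) h.
  apply: le_trans (lerD ih (_ : j.+1%:R * l * (d / 4) <= _)).
    by rewrite -[j.+1%:R]natr1; lra.
  apply: le_trans (_ : j.+1%:R * l * \sum_(q ^ j.+1 <= n < q ^ j.+2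
     | `|psi_rem (N %/ n)| <= 3 * d * (N %/ n)%:R) n%:R^-1 <= _).
    by apply: ler_wpM2l => //; rewrite mulr_ge0// ltW.
  rewrite mulr_sumr -lnnX// [leLHS]big_nat_cond [leRHS]big_nat_cond.
  apply: ler_sum => n /andP[/andP[n1 n2] _].
  by apply: ler_wpM2r; [rewrite invr_ge0|exact: lnn_le].
have pos : 0 <= \sum_(1 <= n < N.+1 | `|psi_rem (N %/ n)| <= 3 * d * (N %/ n)%:R) ln_ n / n%:R.
  by apply: sumr_ge0 => n _; rewrite mulr_ge0 ?lnn_ge0// invr_ge0.
have main : l * d / 4 * ((J%:R - 1) * J%:R / 2) <=
   \sum_(1 <= n < N.+1 | `|psi_rem (N %/ n)| <= 3 * d * (N %/ n)%:R) ln_ n / n%:R.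
  case: (posnP J) => [->|J0]; first by rewrite mulr0 mul0r mulr0.
  have := blocks J.-1; rewrite ltn_predL J0 prednK// => /(_ isT) h.
  have -> : J%:R - 1 = J.-1%:R :> R by rewrite -{1}(prednK J0) -natr1; ring.
  have -> : J%:R = J.-1%:R + 1 :> R by rewrite -{1}(prednK J0) -natr1.
  apply: le_trans h _.
  have qJN : (q ^ J <= N)%N by apply: leq_trans hJ1; rewrite leq_pmulr.
  rewrite [leRHS](@big_cat_nat _ _ _ (q ^ J))//= ?expn_gt0 ?q0//; last exact: leqW.
  rewrite lerDl; apply: sumr_ge0 => n _; by rewrite mulr_ge0 ?lnn_ge0// invr_ge0.
set W := \sum_(_ <= _ < _ | _) _ in pos main *.
set L := ln_ N in Nl hJl *.
have lc : l * d = c * 8 * l ^+ 2.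
  by rewrite /c; field; rewrite gt_eqF.
have [z2|z2] := leP (L - y) (2 * l).
  apply: le_trans pos.
  have -> : c * L ^+ 2 - c * (2 * y + 3 * l) * L = c * (L * ((L - y - 2 * l) - y - l)) by ring.
  apply: mulr_ge0_le0; first exact: ltW.
  by apply: mulr_ge0_le0; lra.
apply: le_trans main; rewrite lc.
have -> : c * 8 * l ^+ 2 / 4 * ((J%:R - 1) * J%:R / 2) =
   c * ((J%:R * l - l) * (J%:R * l)) by field.
have -> : c * L ^+ 2 - c * (2 * y + 3 * l) * L = c * (L ^+ 2 - (2 * y + 3 * l) * L) by ring.
apply: ler_wpM2l; first exact: ltW.
apply: (@le_trans _ _ ((L - y - 2 * l) * (L - y - l))).
  have : 0 <= y ^+ 2 + 3 * (l * y) + 2 * l ^+ 2.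
    by rewrite !addr_ge0 ?mulr_ge0 ?exprn_ge0// ltW.
  lra.
move: hJl; rewrite -natr1 => hJl.
by apply: ler_pM; lra.
Qed.

Lemma sum_lnn_over N : \sum_(1 <= n < N.+1) ln_ n / n%:R <= 2^-1 * (ln_ N ^+ 2 + ln_ N).
Proof.
elim: N => [|N ih]; first by rewrite big_geq// /lnn ln0// expr0n addr0 mulr0.
rewrite big_nat_recr//=; case: N ih => [|N] ih.
  by rewrite big_geq// lnn1 mul0r expr0n !addr0 mulr0.
have l0 := @lnn_ge0 R N.+1; have l0' := @lnn_ge0 R N.+2.
have h1 := @lnnS_le R N.+1 isT; have h2 := @lnnS_ge R N.+1 isT.
have h3 : N.+1%:R^-1 <= 1 :> R by rewrite invf_le1// ler1n.
have h4 : ln_ N.+1 <= ln_ N.+2 by apply: lnn_le.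
have h5 : ln_ N.+2 / N.+2%:R <= ln_ N.+2 * (ln_ N.+2 - ln_ N.+1) by apply: ler_wpM2l.
apply: le_trans (lerD ih h5) _.
have : (ln_ N.+2 - ln_ N.+1) * (ln_ N.+2 - ln_ N.+1) <= (ln_ N.+2 - ln_ N.+1) * 1.
  apply: ler_wpM2l; first by rewrite subr_ge0.
  exact: le_trans h1 h3.
lra.
Qed.

(** Its infimum is the limsup of |r(m)| / m; the constant D absorbs the finitely many small m. *)
Definition psi_rem_bounds : set R :=
  [set alpha | exists2 D : R, 0 <= D & forall m, `|psi_rem m| <= alpha * m%:R + D].

(** In Selberg's inequality the bound alpha N / n becomes 3 d N / n = (s / 2) N / n at the good n.
    This saves at least s c N (log N)^2 = 2 k N (log N)^2, half of which is given up to the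
    lower-order terms. The gain k depends on s alone, not on alpha. *)
Lemma psi_rem_bounds_improve (s : R) : 0 < s < 6 -> exists2 k : R, 0 < k &
  forall alpha, s <= alpha -> psi_rem_bounds alpha -> psi_rem_bounds (alpha - k).
Proof.
move=> /andP[s0 s6]; set d := s / 6.
have d01 : 0 < d < 1 by rewrite /d; lra.
have [c [c0 [D2 [D20 [Y [Y0 hY]]]]]] := good_log_sum d01.
set k := s * c / 2; have k0 : 0 < k by rewrite !divr_gt0// mulr_gt0.
exists k => // alpha sa [D D0 hD].
have a0 : 0 < alpha by lra.
set a3 := alpha - 3 * d; have a30 : s / 2 <= a3 by rewrite /a3 /d; lra.
set D3 := alpha + 2 * D + 2 * a3 * D2 + 160.
have D30 : 0 <= D3.
  by rewrite /D3 !addr_ge0 ?mulr_ge0// ?ltW//; lra.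
have bnd N : (Y <= N)%N ->
    `|psi_rem N| * ln_ N ^+ 2 <= N%:R * ((alpha - 2 * k) * ln_ N ^+ 2 + D3 * (1 + ln_ N)).
  move=> YN; have N0 : (0 < N)%N by apply: leq_trans YN.
  have W := hY N YN.
  have L0 := @lnn_ge0 R N; set L := ln_ N in L0 W *.
  have := psi_rem_selberg_ineq (R := R) N0; rewrite -/L => /le_trans; apply.
  have h1 : \sum_(1 <= n < N.+1) ln_ n * `|psi_rem (N %/ n)| <=
      N%:R * alpha * \sum_(1 <= n < N.+1) ln_ n / n%:R + D * lnfact R N
      - N%:R * a3 * \sum_(1 <= n < N.+1 | `|psi_rem (N %/ n)| <= 3 * d * (N %/ n)%:R) ln_ n / n%:R.
    rewrite [X in _ - _ * X]big_mkcond/= /lnfact ln_fact !mulr_sumr -big_split -sumrB/=.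
    rewrite big_nat [leRHS]big_nat; apply: ler_sum => n /andP[n0 nN].
    have [b _] := @divn_bounds R N n n0.
    have ln0 := @lnn_ge0 R n.
    case: ifP => hg.
      have : ln_ n * `|psi_rem (N %/ n)| <= ln_ n * (3 * d * (N%:R / n%:R)).
        apply: ler_wpM2l => //; apply: le_trans hg _; apply: ler_wpM2l => //.
        by rewrite /d; lra.
      have := mulr_ge0 D0 ln0; rewrite /a3; lra.
    have : ln_ n * `|psi_rem (N %/ n)| <= ln_ n * (alpha * (N%:R / n%:R) + D).
      apply: ler_wpM2l => //; apply: le_trans (hD _) _; rewrite lerD2r.
      by apply: ler_wpM2l => //; exact: ltW.
    lra.
  set S := \sum_(1 <= n < N.+1) ln_ n * _ in h1 *.
  have n0 : 0 <= N%:R :> R by [].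
  have a30' : 0 <= a3 by lra.
  have h2 := ler_wpM2l (mulr_ge0 n0 (ltW a0)) (sum_lnn_over N).
  have h3 := ler_wpM2l D0 (@lnfact_le_mul R N).
  have h4 := ler_wpM2l (mulr_ge0 n0 a30') W.
  rewrite -/L in h2 h3.
  have h5 : N%:R * L ^+ 2 * c * (s / 2) <= N%:R * L ^+ 2 * c * a3.
    by apply: ler_wpM2l => //; rewrite !mulr_ge0 ?exprn_ge0// ltW.
  have h6 : 0 <= N%:R * D3 by rewrite mulr_ge0.
  have h7 : 0 <= N%:R * (alpha + 2 * D + 2 * a3 * D2).
    by rewrite mulr_ge0 ?addr_ge0 ?mulr_ge0// ltW.
  rewrite /k /D3; lra.
have [Z Z1 hZ] := exists_nat_lnn_gt (2 * D3 / k + 1).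
set N0 := maxn Y Z.
have big N : (N0 <= N)%N -> `|psi_rem N| <= (alpha - k) * N%:R.
  move=> hN; have YN : (Y <= N)%N by apply: leq_trans hN; exact: leq_maxl.
  have := hZ N (leq_trans (leq_maxr _ _) hN).
  move=> hL; have := bnd N YN; move: hL; set L := ln_ N => hL hb.
  have q0 : 0 <= 2 * D3 / k by rewrite divr_ge0 ?mulr_ge0// ltW.
  have L1 : 1 < L by lra.
  have L2 : 0 < L ^+ 2 by rewrite exprn_gt0//; lra.
  have kL : 2 * D3 <= k * L.
    have : 2 * D3 / k <= L by lra.
    by rewrite ler_pdivrMr// [L * _]mulrC.
  rewrite -(ler_pM2r L2); apply: le_trans hb _.
  rewrite [(alpha - k) * _]mulrC -mulrA; apply: ler_wpM2l => //.
  have : D3 * (1 + L) <= D3 * (2 * L) by apply: ler_wpM2l => //; lra.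
  have : 2 * D3 * L <= k * L * L by apply: ler_wpM2r => //; lra.
  lra.
exists (8 * N0%:R + `|alpha - k| * N0%:R); first by rewrite addr_ge0// mulr_ge0.
move=> m; have [hm|hm] := leqP N0 m.
  by apply: le_trans (big _ hm) _; rewrite lerDl addr_ge0// mulr_ge0.
apply: le_trans (psi_rem_le m) _.
have mN : m%:R <= N0%:R :> R by rewrite ler_nat ltnW.
have : `|alpha - k| * m%:R <= `|alpha - k| * N0%:R by apply: ler_wpM2l.
have : - (`|alpha - k| * m%:R) <= (alpha - k) * m%:R.
  by rewrite -mulNr ler_wpM2r// lerNl -normrN ler_norm.
lra.
Qed.

(** If the infimum s of the admissible slopes were positive, a slope within k of it could be lowered
    by k, below s, because the gain k is uniform over the slopes at least [s']. *)
Theorem prime_number_theorem (eps : R) : 0 < eps -> psi_rem_bounds eps.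
Proof.
move=> eps0.
have S8 : psi_rem_bounds 8 by exists 0 => // m; rewrite addr0; exact: psi_rem_le.
have S0 : lbound psi_rem_bounds 0.
  move=> a [D D0 hD]; rewrite leNgt; apply/negP => a0.
  have [n n0 hn] := exists_nat_gt (D / - a).
  have := hD n; rewrite leNgt => /negP; apply.
  apply: lt_le_trans (normr_ge0 _).
  by move: hn; rewrite ltr_pdivrMr ?oppr_gt0//; lra.
have hS : has_inf psi_rem_bounds by split; [exists 8|exists 0].
set s := inf psi_rem_bounds.
have s_lb a : psi_rem_bounds a -> s <= a by apply: ge_inf; case: hS.
have s0 : 0 <= s by apply: lb_le_inf => //; exists 8.
have {}s0 : s = 0.
  apply/eqP; rewrite eq_le s0 andbT leNgt; apply/negP => sp.
  (* The cap keeps [s'] below 6, as the improvement requires. *)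
  pose s' := Num.min s 5.
  have s'06 : 0 < s' < 6 by rewrite /s' lt_min sp/= gt_min; apply/andP; split; lra.
  have [k k0 hk] := psi_rem_bounds_improve s'06.
  have [a Sa ha] := inf_adherent k0 hS.
  have := s_lb _ (hk a _ Sa); rewrite -/s in ha.
  have s's : s' <= s by rewrite /s' ge_min lexx.
  by move=> /(_ (le_trans s's (s_lb _ Sa))); lra.
have [a [D D0 hD] ha] := inf_adherent eps0 hS.
rewrite -/s s0 add0r in ha.
exists D => // m; apply: le_trans (hD m) _.
by rewrite lerD2r ler_wpM2r// ltW.
Qed.

Corollary psi_asymptotic (eps : R) : 0 < eps ->
  exists2 D : R, 0 <= D & forall n, psi n <= (1 + eps) * n%:R + D.
Proof.
move=> /prime_number_theorem[D D0 hD]; exists D => // n.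
by have := le_trans (ler_norm _) (hD n); rewrite /psi_rem; lra.
Qed.

End PrimeNumberTheorem.

(** * Sondow's linear forms *)

Section PartialFractions.
Context {R : realType}.
Implicit Types (n k l m : nat) (x z : R).

(** The residue of n! / (x (x+1) ... (x+n)) at x = -k. *)
Definition acoef n k : R := (-1) ^+ k * 'C(n, k)%:R.

Lemma acoefSS n k : acoef n.+1 k.+1 = acoef n k.+1 - acoef n k.
Proof. by rewrite /acoef binS natrD exprS; ring. Qed.

Lemma acoef0 n : acoef n 0 = 1. Proof. by rewrite /acoef bin0 mulr1. Qed.

Lemma acoef_small n k : (n < k)%N -> acoef n k = 0.
Proof. by move=> nk; rewrite /acoef bin_small// mulr0. Qed.

Lemma acoef_sqr n k : acoef n k ^+ 2 = ('C(n, k) ^ 2)%:R.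
Proof. by rewrite /acoef exprMn sqrr_sign mul1r natrX. Qed.

Lemma sum_acoef n : (0 < n)%N -> \sum_(k < n.+1) acoef n k = 0.
Proof.
move=> n0; have := exprBn (1 : R) 1 n; rewrite subrr expr0n gtn_eqF// => e.
rewrite [RHS]e; apply: eq_bigr => k _.
by rewrite /acoef !expr1n !mulr1 mulr_natr.
Qed.

(* At an integer [z <= n] the term [l = z] vanishes, because [0^-1 = 0]. *)
Definition pfsum n z : R := \sum_(l < n.+1) acoef n l / (l%:R - z).

Lemma pfsumS n z : pfsum n.+1 z = pfsum n z - pfsum n (z - 1).
Proof.
have -> : pfsum n z = \sum_(l < n.+2) acoef n l / (l%:R - z).
  by rewrite [RHS]big_ord_recr/= acoef_small// mul0r addr0.
rewrite /pfsum big_ord_recl [in RHS]big_ord_recl !acoef0 -addrA; congr (_ + _).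
rewrite -sumrB; apply: eq_bigr => l _.
rewrite lift0 acoefSS mulrBl; congr (_ - _ / _).
by rewrite -natr1; ring.
Qed.

Lemma pfsum_opp n x : 0 < x -> pfsum n (- x) = n`!%:R / \prod_(i < n.+1) (x + i%:R).
Proof.
elim: n x => [|n ih] x x0.
  by rewrite /pfsum !big_ord1 acoef0 opprK fact0 add0r addr0.
have x1 : 0 < x + 1 by rewrite addr_gt0.
have P0 m : \prod_(i < m.+1) (x + i%:R) = x * \prod_(i < m) (x + 1 + i%:R).
  rewrite big_ord_recl addr0; congr (_ * _).
  by apply: eq_bigr => i _; rewrite lift0 -natr1; ring.
rewrite pfsumS -opprD !ih// !P0 big_ord_recr/=.
have Q0 : 0 < \prod_(i < n) (x + 1 + i%:R).
  by apply: prodr_gt0 => i _; rewrite ltr_wpDr.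
rewrite factS natrM -[n.+1%:R]natr1.
field; rewrite !gt_eqF// ?ltr_wpDr//.
Qed.

Lemma pfsum_refl n z : pfsum n (n%:R - z) = (-1) ^+ n.+1 * pfsum n z.
Proof.
rewrite /pfsum mulr_sumr (reindex_inj rev_ord_inj)/=; apply: eq_bigr => l _.
have ln : (l <= n)%N by rewrite -ltnS.
rewrite subSS /acoef bin_sub// natrB// mulrA [in RHS]mulrA.
have -> : n%:R - l%:R - (n%:R - z) = - (l%:R - z) by ring.
rewrite invrN mulrN -mulNr; congr (_ / _); rewrite -mulNr; congr (_ * _).
by rewrite -signr_odd oddB// signr_addb !signr_odd exprS mulN1r mulNr.
Qed.

Lemma pfsum_opp1 n : pfsum n (- 1) = n.+1%:R^-1.
Proof.
rewrite pfsum_opp//.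
have -> : \prod_(i < n.+1) (1 + i%:R) = n.+1`!%:R :> R.
  elim: n => [|n ih]; first by rewrite big_ord1 addr0.
  by rewrite big_ord_recr/= ih [in RHS]factS mulnC natrM nat1r.
rewrite factS natrM invfM mulrCA mulfV ?mulr1// pnatr_eq0 -lt0n; exact: fact_gt0.
Qed.

(** This is the constant term of the unsquared expansion at its pole x = -k. Induction by Pascal's
    rule; at the ends k = 0 and k = n + 1 one of the two terms is evaluated off the poles, where
    [pfsum_opp1] applies, after a reflection in the second case. *)
Lemma pfsum_nat n k : (k <= n)%N ->
  pfsum n k%:R = acoef n k * (harm R k - harm R (n - k)).
Proof.
elim: n k => [|n ih] k.
  by rewrite leqn0 => /eqP->; rewrite /pfsum big_ord1 subrr invr0 mulr0 subrr mulr0.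
case: k => [_|k].
  have := ih 0%N isT; rewrite pfsumS sub0r pfsum_opp1 !acoef0 !subn0 !mul1r => ->.
  by rewrite harmS opprD addrA.
rewrite ltnS pfsumS -[k.+1%:R]natr1 addrK leq_eqVlt => /orP[/eqP->|kn].
  rewrite ih// subnn natr1.
  have -> : n.+1%:R = n%:R - (-1) :> R by rewrite opprK natr1.
  rewrite pfsum_refl pfsum_opp1 subnn harm0 !subr0 harmS /acoef !binn exprS; ring.
rewrite natr1 ih// ih ?(ltnW kn)// acoefSS subSS.
have -> : (n - k = (n - k.+1).+1)%N by lia.
rewrite !harmS.
have h : acoef n k.+1 * (n - k.+1).+1%:R^-1 = - (acoef n k * k.+1%:R^-1).
  have := mul_bin_left n k; rewrite (_ : n - k = (n - k.+1).+1)%N; last by lia.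
  move=> /(congr1 (fun m => m%:R : R)); rewrite !natrM => e.
  have p0 : (n - k.+1).+1%:R != 0 :> R by rewrite pnatr_eq0.
  have q0 : k.+1%:R != 0 :> R by rewrite pnatr_eq0.
  move: p0 q0 e; rewrite /acoef exprS.
  move: ((n - k.+1).+1%:R : R) (k.+1%:R : R) => p q p0 q0 e.
  apply: (mulfI (mulf_neq0 q0 p0)).
  transitivity (- (-1) ^+ k * (q * 'C(n, k.+1)%:R)); first by field.
  by rewrite e; field.
move: h; set i := (n - k.+1).+1%:R^-1; set j := k.+1%:R^-1 => h.
apply/eqP; rewrite -subr_eq0; apply/eqP.
transitivity (acoef n k.+1 * i + acoef n k * j); first by ring.
by rewrite h addNr.
Qed.

(** The residue at x = -k of the squared function: twice the residue of the function itself times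
    its constant term there. *)
Definition bcoef n k : R := 2 * acoef n k * pfsum n k%:R.

Lemma bcoefE n k : (k <= n)%N ->
  bcoef n k = 2 * ('C(n, k) ^ 2)%:R * (harm R k - harm R (n - k)).
Proof. by move=> kn; rewrite /bcoef pfsum_nat// -acoef_sqr; ring. Qed.

Lemma bcoef_rev n k : (k <= n)%N -> bcoef n (n - k) = - bcoef n k.
Proof.
by move=> kn; rewrite !bcoefE ?leq_subr// bin_sub// subKn//; ring.
Qed.

Lemma sum_acoef_sqr n : \sum_(k < n.+1) acoef n k ^+ 2 = 'C(n.*2, n)%:R.
Proof.
rewrite -addnn -binomial.Vandermonde natr_sum; apply: eq_bigr => k _.
by rewrite acoef_sqr bin_sub ?mulnn// -ltnS.
Qed.

Lemma sum_bcoef n : \sum_(k < n.+1) bcoef n k = 0.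
Proof.
have : \sum_(k < n.+1) bcoef n k = - \sum_(k < n.+1) bcoef n k.
  rewrite -sumrN {1}(reindex_inj rev_ord_inj)/=; apply: eq_bigr => k _.
  by rewrite subSS bcoef_rev// -ltnS.
lra.
Qed.

(* Symmetrizing the double sum replaces [k / (l - k)] by [-1/2] off the diagonal. *)
Lemma sum_mul_bcoef n : (0 < n)%N -> \sum_(k < n.+1) k%:R * bcoef n k = 'C(n.*2, n)%:R.
Proof.
move=> n0; rewrite -sum_acoef_sqr.
pose T (k l : 'I_n.+1) : R := k%:R * acoef n k * acoef n l / (l%:R - k%:R).
have e : \sum_(k < n.+1) k%:R * bcoef n k = 2 * \sum_(k < n.+1) \sum_(l < n.+1) T k l.
  rewrite mulr_sumr; apply: eq_bigr => k _; rewrite /bcoef /pfsum !mulr_sumr.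
  by apply: eq_bigr => l _; rewrite /T; ring.
rewrite e mulr2n mulrDl mul1r [X in X + _ = _]exchange_big -big_split/=.
transitivity (\sum_(k < n.+1) (acoef n k ^+ 2 - acoef n k * \sum_(l < n.+1) acoef n l)).
  apply: eq_bigr => k _; rewrite -big_split/= (bigD1 k)//= /T subrr invr0 !mulr0 !add0r.
  rewrite [in RHS](bigD1 k)//= mulrDr opprD addrA -expr2 subrr add0r mulr_sumr -sumrN.
  apply: eq_bigr => l lk.
  have lk' : l%:R - k%:R != 0 :> R by rewrite subr_eq0 eqr_nat.
  have kl' : k%:R - l%:R != 0 :> R by rewrite -opprB oppr_eq0.
  by field; rewrite lk' kl'.
by rewrite sum_acoef//; apply: eq_bigr => k _; rewrite mulr0 subr0.
Qed.

Lemma partial_fractions n x : 0 < x ->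
  (n`!%:R / \prod_(i < n.+1) (x + i%:R)) ^+ 2 =
  \sum_(k < n.+1) (acoef n k ^+ 2 / (x + k%:R) ^+ 2 + bcoef n k / (x + k%:R)).
Proof.
move=> x0; rewrite -pfsum_opp// expr2.
have xk (k : 'I_n.+1) : x + k%:R != 0 by rewrite gt_eqF// ltr_wpDr.
have e : pfsum n (- x) = \sum_(k < n.+1) acoef n k / (x + k%:R).
  by apply: eq_bigr => k _; rewrite opprK addrC.
(* Off the diagonal, 1 / ((x + k) (x + l)) = (1 / (x + k) - 1 / (x + l)) / (l - k), which gives
   [T k l + T l k]; on it [T] is 0, as [0^-1 = 0]. *)
pose T (k l : 'I_n.+1) : R := acoef n k * acoef n l / (l%:R - k%:R) / (x + k%:R).
transitivity (\sum_(k < n.+1) acoef n k ^+ 2 / (x + k%:R) ^+ 2 +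
  (\sum_(k < n.+1) \sum_(l < n.+1) T k l + \sum_(k < n.+1) \sum_(l < n.+1) T l k)).
  rewrite -!big_split e mulr_suml; apply: eq_bigr => k _ /=.
  rewrite mulr_sumr -big_split/= (bigD1 k)//= [in RHS](bigD1 k)//=.
  rewrite {1 2}/T subrr invr0 !(mulr0, mul0r) !add0r; congr (_ + _).
    by field; exact: xk.
  apply: eq_bigr => l lk.
  have lk' : l%:R - k%:R != 0 :> R by rewrite subr_eq0 eqr_nat.
  have kl' : k%:R - l%:R != 0 :> R by rewrite -opprB oppr_eq0.
  by rewrite /T; field; rewrite lk' kl' !xk.
rewrite big_split/=; congr (_ + _).
rewrite [X in _ + X]exchange_big -mulr2n -mulr_natl mulr_sumr; apply: eq_bigr => k _ /=.
rewrite /bcoef /pfsum [in RHS]mulr_sumr mulr_suml mulr_sumr; apply: eq_bigr => l _.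
by rewrite /T; ring.
Qed.

End PartialFractions.
Arguments acoef R n k : clear implicits.
Arguments bcoef R n k : clear implicits.

(** * The linear form in Euler's constant and logarithms *)

Section LinearForm.
Context {R : realType}.
Implicit Types (n k m N : nat) (x : R).
Local Notation acoef := (acoef R).
Local Notation bcoef := (bcoef R).

Lemma le0_of_le_divn (y K : R) : (forall M, (0 < M)%N -> y <= K / M%:R) -> y <= 0.
Proof.
move=> h; rewrite leNgt; apply/negP => y0.
have [M M0 hM] := exists_nat_gt (K / y).
have := h M M0; rewrite ler_pdivlMr ?ltr0n//.
by move: hM; rewrite ltr_pdivrMr// mulrC => /lt_le_trans h1 /h1; rewrite ltxx.
Qed.

Lemma lnn_addn_sub N k : (0 < N)%N -> 0 <= lnn R (N + k) - lnn R N <= k%:R / N%:R.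
Proof.
move=> N0; have n0 : 0 < N%:R :> R by rewrite ltr0n.
rewrite subr_ge0 lnn_le ?leq_addr//=.
apply: le_trans (ln_sub_le n0 _) _; first by rewrite ltr0n addn_gt0 N0.
by rewrite natrD mulrDl divff ?gt_eqF// addrC addKr.
Qed.

Definition tail_kernel n x : R := (n`!%:R / \prod_(i < n.+1) (x + i%:R)) ^+ 2.

(* The integral of [tail_kernel n] over [[x, +oo[]. *)
Definition tail_integral n x : R :=
  \sum_(k < n.+1) (acoef n k ^+ 2 / (x + k%:R) - bcoef n k * ln (x + k%:R)).

Lemma is_derive_inv_ln (a b c x : R) : 0 < x + c ->
  is_derive x 1 (fun y => a / (y + c) - b * ln (y + c)) (- (a / (x + c) ^+ 2 + b / (x + c))).
Proof.
move=> xc.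
have d1 : is_derive x 1 (fun y : R => y + c) 1 by apply: is_derive_eq; rewrite addr0.
have xc' : x + c != 0 by rewrite gt_eqF.
have d2 := @is_deriveV R (fun y => y + c) x 1 1 xc' d1.
have d3 : is_derive x 1 (@ln R \o (fun y : R => y + c)) ((x + c)^-1 * 1).
  by apply: is_derive1_comp; exact: is_derive1_ln.
have d4 := @is_deriveZ R R R^o (@ln R \o (fun y : R => y + c)) b x 1 _ d3.
have d5 := @is_deriveZ R R R^o _ a x 1 _ d2.
apply: (@is_derive_eq _ _ _ _ _ _ _ _ (is_deriveB d5 d4)).
by rewrite /GRing.scale /=; field.
Qed.

Lemma is_derive_tail_integral n x : 0 < x ->
  is_derive x 1 (tail_integral n) (- tail_kernel n x).
Proof.
move=> x0.
have := @is_derive_sum R R R^o n.+1 (fun (k : 'I_n.+1) y =>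
  acoef n k ^+ 2 / (y + k%:R) - bcoef n k * ln (y + k%:R)) x 1 _
  (fun k : 'I_n.+1 => is_derive_inv_ln _ _ (ltr_wpDr (ler0n R (nat_of_ord k)) x0)).
rewrite fct_sumE => h; apply: (@is_derive_eq _ _ _ _ _ _ _ _ h).
by rewrite /tail_kernel partial_fractions// sumrN.
Qed.

Definition tail_scale n : R := n.+1%:R / 'C(n.*2, n)%:R.

Lemma prod_addn_fact m j : (\prod_(i < j) (m.+1 + i) * m`! = (m + j)`!)%N.
Proof.
elim: j => [|j ih]; first by rewrite big_ord0 mul1n addn0.
by rewrite big_ord_recr/= mulnAC ih addnS factS mulnC addSn.
Qed.

(** The factors x and x + n are bounded below by x, for the decay; the n - 1 others by their values
    at x = n + 1, whose product makes up the central binomial coefficient. After squaring, the decay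
    x^-4 survives one integration and one summation. *)
Lemma tail_kernel_le n x : (0 < n)%N -> n.+1%:R <= x ->
  tail_kernel n x <= tail_scale n ^+ 2 / x ^+ 4.
Proof.
case: n => // n _ nx.
have x0 : 0 < x by apply: lt_le_trans nx; rewrite ltr0n.
have Px : 0 < \prod_(i < n.+2) (x + i%:R) by apply: prodr_gt0 => i _; rewrite ltr_wpDr.
have -> : tail_scale n.+1 ^+ 2 / x ^+ 4 = (tail_scale n.+1 / x ^+ 2) ^+ 2.
  by rewrite [in RHS]expr_div_n -exprM.
have t0 : 0 <= n.+1`!%:R / \prod_(i < n.+2) (x + i%:R) by rewrite divr_ge0// ltW.
have t1 : 0 <= tail_scale n.+1 / x ^+ 2 by rewrite !divr_ge0// exprn_ge0// ltW.
rewrite /tail_kernel; apply: lerXn2r; rewrite ?nnegrE//.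
have low : (\prod_(i < n) (n.+2.+1 + i))%N%:R * x ^+ 2 <= \prod_(i < n.+2) (x + i%:R).
  rewrite big_ord_recl big_ord_recr addr0 lift0.
  have -> : \prod_(i < n) (x + (lift ord0 (widen_ord (leqnSn n) i))%:R) =
      \prod_(i < n) (x + i.+1%:R).
    by apply: eq_bigr => i _; rewrite lift0.
  rewrite expr2 mulrCA; apply: ler_wpM2l; first exact: ltW.
  apply: ler_pM => //; first exact: ltW.
    rewrite natr_prod; apply: ler_prod => i _; rewrite ler0n/=.
    by rewrite addSnnS natrD lerD2r.
  by rewrite lerDl.
rewrite ler_pdivrMr// mulrAC ler_pdivlMr ?exprn_gt0//.
have C0 : 0 < 'C(n.+1.*2, n.+1)%:R :> R by rewrite ltr0n bin_gt0 -addnn leq_addr.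
rewrite /tail_scale mulrAC ler_pdivlMr//.
have e : (n.+1`! * 'C(n.+1.*2, n.+1) = n.+2 * \prod_(i < n) (n.+2.+1 + i))%N.
  apply/eqP; rewrite -(eqn_pmul2r (fact_gt0 n.+1)); apply/eqP.
  transitivity (n.+1.*2)`!.
    have := @bin_fact n.+1.*2 n.+1; rewrite -addnn leq_addr addnK => <- //; ring.
  rewrite mulnAC -factS mulnC prod_addn_fact; congr (_`!); lia.
have e' : n.+1`!%:R * 'C(n.+1.*2, n.+1)%:R = n.+2%:R * (\prod_(i < n) (n.+2.+1 + i))%N%:R :> R.
  by rewrite -!natrM e.
rewrite mulrAC e' -mulrA; exact: ler_wpM2l.
Qed.

Lemma tail_integral_step n m : (0 < n)%N -> (n < m)%N ->
  0 <= tail_integral n m%:R - tail_integral n m.+1%:R <= tail_scale n ^+ 2 / m%:R ^+ 4.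
Proof.
move=> n0 nm; have m0 : 0 < m%:R :> R by rewrite ltr0n; lia.
have der x : x \in `[m%:R, m.+1%:R] -> is_derive x 1 (tail_integral n) (- tail_kernel n x).
  by rewrite in_itv/= => /andP[mx _]; apply: is_derive_tail_integral; exact: lt_le_trans mx.
have mm : m%:R < m.+1%:R :> R by rewrite ltr_nat.
have doo x : x \in `]m%:R, m.+1%:R[ -> is_derive x 1 (tail_integral n) (- tail_kernel n x).
  by move=> xm; apply: der; apply: subset_itv_oo_cc.
have cont : {within `[m%:R, m.+1%:R], continuous (tail_integral n)}.
  by apply: derivable_within_continuous => x xm; have [] := der x xm.
have [c] := @MVT R (tail_integral n) (fun x => - tail_kernel n x) m%:R m.+1%:R mm doo cont.
rewrite in_itv/= => /andP[mc _].
have -> : m.+1%:R - m%:R = 1 :> R by rewrite -natr1 addrAC subrr add0r.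
rewrite mulr1 => e.
have -> : tail_integral n m%:R - tail_integral n m.+1%:R = tail_kernel n c by lra.
rewrite /tail_kernel sqr_ge0/=.
have nm' : n.+1%:R <= m%:R :> R by rewrite ler_nat.
have c0 : 0 < c by apply: lt_trans mc.
apply: le_trans (tail_kernel_le n0 (le_trans nm' (ltW mc))) _.
apply: ler_wpM2l; first exact: sqr_ge0.
by rewrite lef_pV2 ?posrE ?exprn_gt0// lerXn2r ?nnegrE ?(ltW m0) ?(ltW c0) ?(ltW mc).
Qed.

(** Since the [bcoef] sum to 0, each log(M + k) may be replaced by log(M + k) - log M <= k / M; so
    the primitive vanishes at infinity. *)
Lemma tail_integral_bound n M : (0 < M)%N ->
  `|tail_integral n M%:R| <=
  (\sum_(k < n.+1) (acoef n k ^+ 2 + `|bcoef n k| * k%:R)) / M%:R.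
Proof.
move=> M0; have M0' : 0 < M%:R :> R by rewrite ltr0n.
have -> : tail_integral n M%:R = \sum_(k < n.+1) (acoef n k ^+ 2 / (M + k)%:R
   - bcoef n k * (lnn R (M + k) - lnn R M)).
  have z : \sum_(k < n.+1) bcoef n k * lnn R M = 0 by rewrite -mulr_suml sum_bcoef mul0r.
  transitivity (tail_integral n M%:R + \sum_(k < n.+1) bcoef n k * lnn R M).
    by rewrite z addr0.
  rewrite /tail_integral -big_split/=; apply: eq_bigr => k _.
  by rewrite /lnn natrD; ring.
rewrite mulr_suml; apply: le_trans (ler_norm_sum _ _ _) _; apply: ler_sum => k _.
apply: le_trans (ler_normB _ _) _; rewrite mulrDl; apply: lerD.
  rewrite ger0_norm ?divr_ge0 ?sqr_ge0//; apply: ler_wpM2l; first exact: sqr_ge0.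
  by rewrite lef_pV2 ?posrE ?ltr0n ?addn_gt0 ?M0// ler_nat leq_addr.
have /andP[h1 h2] := lnn_addn_sub k M0.
rewrite normrM -mulrA; apply: ler_wpM2l => //.
by rewrite ger0_norm.
Qed.

(** The right side is h(u) - h(u + 1) for h(u) = 1 / (u (u - 1)), and h(u) = 1 / (u - 1) - 1 / u is
    a difference too, so both summations of the bound telescope. *)
Lemma inv_pow4_le (u : R) : 2 <= u -> 1 / u ^+ 4 <= (u - 1)^-1 / u - u^-1 / (u + 1).
Proof.
move=> u2; have u0 : 0 < u by lra.
have u10 : 0 < u - 1 by lra.
have u10' : 0 < u + 1 by lra.
have -> : (u - 1)^-1 / u - u^-1 / (u + 1) = 2 / ((u - 1) * u * (u + 1)).
  by field; rewrite !gt_eqF.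
have p0 : 0 < (u - 1) * u * (u + 1) by rewrite !mulr_gt0.
rewrite ler_pdivrMr ?exprn_gt0// mulrAC ler_pdivlMr// mul1r.
have h1 : 0 <= u ^+ 3 by rewrite exprn_ge0// ltW.
have h2 : u ^+ 3 * 1 <= u ^+ 3 * u by apply: ler_wpM2l => //; lra.
lra.
Qed.

Lemma tail_integral_itv n m : (0 < n)%N -> (n < m)%N ->
  0 <= tail_integral n m%:R <= tail_scale n ^+ 2 * ((m%:R - 1)^-1 - m%:R^-1).
Proof.
move=> n0 nm; have s0 := sqr_ge0 (tail_scale n).
pose h k : R := (k%:R - 1)^-1 / k%:R.
have hE k : (1 < k)%N -> (k%:R - 1)^-1 - k%:R^-1 = h k.
  move=> k1; have k1' : 1 < k%:R :> R by rewrite ltr1n.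
  by rewrite /h; field; rewrite subr_eq0 !gt_eqF//; lra.
have h0 k : 0 <= h k.
  case: k => [|k]; first by rewrite /h invr0 mulr0.
  by rewrite /h -natr1 addrK mulr_ge0// invr_ge0 ?addr_ge0.
have tele j : 0 <= tail_integral n m%:R - tail_integral n (m + j)%:R <=
    tail_scale n ^+ 2 * (h m - h (m + j)%N).
  elim: j => [|j ih]; first by rewrite addn0 !subrr mulr0 lexx.
  have /andP[i1 i2] := ih; rewrite addnS.
  have nmj : (n < m + j)%N by lia.
  have /andP[h1 h2] := tail_integral_step n0 nmj.
  have u2 : 2 <= (m + j)%:R :> R by rewrite ler_nat; lia.
  have := inv_pow4_le u2; have -> : (m + j)%:R^-1 / ((m + j)%:R + 1) = h (m + j).+1 :> R.
    by rewrite /h -natr1 addrK.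
  rewrite -/(h _) => /(ler_wpM2l s0); rewrite mul1r => h3.
  by apply/andP; split; lra.
have nonneg : 0 <= \sum_(k < n.+1) (acoef n k ^+ 2 + `|bcoef n k| * k%:R).
  by apply: sumr_ge0 => k _; rewrite addr_ge0 ?sqr_ge0 ?mulr_ge0.
have small j : (0 < j)%N -> `|tail_integral n (m + j)%:R| <=
    (\sum_(k < n.+1) (acoef n k ^+ 2 + `|bcoef n k| * k%:R)) / j%:R.
  move=> j0; apply: le_trans (tail_integral_bound n _) _; first by lia.
  apply: ler_wpM2l => //.
  by rewrite lef_pV2 ?posrE ?ltr0n ?ler_nat ?leq_addl//; lia.
apply/andP; split; rewrite -subr_le0; apply: (@le0_of_le_divn _
  (\sum_(k < n.+1) (acoef n k ^+ 2 + `|bcoef n k| * k%:R))) => j j0.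
  have /andP[i1 _] := tele j; have := small j j0; rewrite ler_norml => /andP[]; lra.
rewrite hE; last by lia.
have /andP[_ i2] := tele j; have := small j j0; rewrite ler_norml => /andP[_].
have := mulr_ge0 s0 (h0 (m + j)%N); lra.
Qed.

Definition linear_form n : R :=
  'C(n.*2, n)%:R * euler_gamma R
  - \sum_(k < n.+1) acoef n k ^+ 2 * harm R (n + k)
  + \sum_(k < n.+1) bcoef n k * lnfact R (n + k).

Lemma sum_tail_integral n j :
  \sum_(i < j) tail_integral n (n + i).+1%:R =
  \sum_(k < n.+1) (acoef n k ^+ 2 * (harm R (n + j + k) - harm R (n + k))
    - bcoef n k * (lnfact R (n + j + k) - lnfact R (n + k))).
Proof.
elim: j => [|j ih].
  by rewrite big_ord0 big1// => k _; rewrite addn0 !subrr !mulr0 subrr.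
rewrite big_ord_recr/= ih /tail_integral -big_split/=; apply: eq_bigr => k _.
rewrite addnS addSn harmS lnfactS /lnn -natrD addSn; ring.
Qed.

Lemma sum_tail_integral_itv n j : (0 < n)%N ->
  0 <= \sum_(i < j) tail_integral n (n + i).+1%:R <= tail_scale n ^+ 2.
Proof.
move=> n0; have s0 := sqr_ge0 (tail_scale n).
have H i : 0 <= tail_integral n (n + i).+1%:R <=
    tail_scale n ^+ 2 * ((n + i)%:R^-1 - (n + i).+1%:R^-1).
  by have := @tail_integral_itv n (n + i).+1 n0 (leq_addr _ _); rewrite -{3}natr1 addrK.
apply/andP; split; first by apply: sumr_ge0 => i _; have /andP[] := H i.
apply: (@le_trans _ _ (tail_scale n ^+ 2 * (n%:R^-1 - (n + j)%:R^-1))).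
  elim: j => [|j ih]; first by rewrite big_ord0 addn0 subrr mulr0.
  rewrite big_ord_recr/= addnS; have /andP[_ h] := H j.
  apply: le_trans (lerD ih h) _; rewrite -mulrDr.
  by rewrite addrA subrK.
rewrite -[leRHS]mulr1; apply: ler_wpM2l => //.
have : n%:R^-1 <= 1 :> R by rewrite invf_le1 ?ltr0n// ler1n.
have : 0 <= (n + j)%:R^-1 :> R by [].
by move: (_^-1) (_^-1) => u v; lra.
Qed.

(** With N = n + j, H_(N+k) = gamma + log N + O(1/N) and log (N+k)! = log N! + k log N + O(1/N). The
    terms in log N! cancel since the [bcoef] sum to 0, those in log N since the sums of k
    [bcoef n k] and of [acoef n k ^+ 2] are both 'C(2n, n). *)
Lemma linear_form_approx n j : (0 < n)%N -> (0 < j)%N ->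
  `|linear_form n - \sum_(i < j) tail_integral n (n + i).+1%:R| <=
  (\sum_(k < n.+1) (acoef n k ^+ 2 * (1 + k%:R) + `|bcoef n k| * (k * k)%:R)) / j%:R.
Proof.
move=> n0 j0; set N := (n + j)%N.
have N0 : (0 < N)%N by lia.
have jN : N%:R^-1 <= j%:R^-1 :> R.
  by rewrite lef_pV2 ?posrE ?ltr0n// ler_nat leq_addl.
have -> : linear_form n - \sum_(i < j) tail_integral n (n + i).+1%:R =
  \sum_(k < n.+1) (acoef n k ^+ 2 * (euler_gamma R - harm R (N + k) + lnn R N)
    + bcoef n k * (lnfact R (N + k) - lnfact R N - k%:R * lnn R N)).
  rewrite sum_tail_integral /linear_form.
  have -> : 'C(n.*2, n)%:R * euler_gamma R = \sum_(k < n.+1)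
     (acoef n k ^+ 2 * (euler_gamma R + lnn R N) - bcoef n k * lnfact R N
       - k%:R * bcoef n k * lnn R N).
    rewrite !sumrB -!mulr_suml sum_acoef_sqr sum_bcoef sum_mul_bcoef//; ring.
  rewrite -sumrB -big_split/= -sumrB; apply: eq_bigr => k _; rewrite -/N; ring.
rewrite mulr_suml; apply: le_trans (ler_norm_sum _ _ _) _; apply: ler_sum => k _.
apply: le_trans (ler_normD _ _) _; rewrite mulrDl; apply: lerD.
  rewrite normrM ger0_norm ?sqr_ge0// -mulrA; apply: ler_wpM2l; first exact: sqr_ge0.
  have Nk0 : (0 < N + k)%N by lia.
  have /andP[g1 g2] := @euler_gamma_bounds R _ Nk0.
  have /andP[l1 l2] := lnn_addn_sub k N0.
  have h := @lnnS_le R _ Nk0.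
  have : (N + k)%:R^-1 <= N%:R^-1 :> R.
    by rewrite lef_pV2 ?posrE ?ltr0n// ler_nat leq_addr.
  have : k%:R * N%:R^-1 <= k%:R * j%:R^-1 :> R by apply: ler_wpM2l.
  have : 0 <= j%:R^-1 :> R by [].
  have : 0 <= k%:R * j%:R^-1 :> R by rewrite mulr_ge0.
  move: jN g1 g2 l1 l2 h; rewrite mulrDl mul1r.
  move: (N%:R^-1 : R) (j%:R^-1 : R) ((N + k)%:R^-1 : R) => a b c.
  by move=> *; rewrite ler_norml; apply/andP; split; lra.
rewrite normrM -mulrA; apply: ler_wpM2l => //.
have e (m : nat) : (m <= k)%N -> 0 <= lnfact R (N + m) - lnfact R N - m%:R * lnn R N <=
    m%:R * (k%:R / N%:R).
  elim: m => [|m ih] mk; first by rewrite addn0 subrr !mul0r subrr lexx.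
  have /andP[i1 i2] := ih (ltnW mk).
  rewrite addnS lnfactS -addnS -natr1.
  have /andP[l1 l2] := lnn_addn_sub m.+1 N0.
  have : m.+1%:R / N%:R <= k%:R / N%:R :> R by rewrite ler_wpM2r// ler_nat.
  by move=> h; apply/andP; split; lra.
have /andP[i1 i2] := e k (leqnn k); rewrite ger0_norm//; apply: le_trans i2 _.
rewrite natrM -mulrA; apply: ler_wpM2l => //; exact: ler_wpM2l.
Qed.

Theorem linear_form_itv n : (0 < n)%N -> 0 <= linear_form n <= tail_scale n ^+ 2.
Proof.
move=> n0; set K := \sum_(k < n.+1) (acoef n k ^+ 2 * (1 + k%:R) + `|bcoef n k| * (k * k)%:R).
apply/andP; split; rewrite -subr_le0; apply: (@le0_of_le_divn _ K) => j j0;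
  have := linear_form_approx n0 j0; have /andP[] := @sum_tail_integral_itv n j n0;
  rewrite -/K ler_norml => h1 h2 /andP[]; lra.
Qed.

End LinearForm.
Arguments linear_form R n : clear implicits.
Arguments tail_scale R n : clear implicits.

(** * From the linear form to log S_n *)

Section SondowProduct.
Context {R : realType}.
Implicit Types (n k m q : nat).
Local Notation acoef := (acoef R).
Local Notation bcoef := (bcoef R).

Lemma sum_bcoef_sym n a b : (a + b = n.+1)%N -> \sum_(a <= k < b) bcoef n k = 0.
Proof.
move=> ab.
have : \sum_(a <= k < b) bcoef n k = - \sum_(a <= k < b) bcoef n k.
  rewrite -sumrN {1}big_nat_rev big_nat [RHS]big_nat.
  apply: eq_bigr => k /andP[ak kb].
  by rewrite ab subSS bcoef_rev//; lia.
lra.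
Qed.

(** The indices n - m < k < m are symmetric about n / 2, where [bcoef] is antisymmetric, and cancel.
    This accounts for min(m - 1, n - m) in S_n, which leaves only k < n / 2, where [bcoef] is
    negative. *)
Lemma sum_bcoef_minn n m : (0 < m <= n)%N ->
  \sum_(0 <= k < (minn m.-1 (n - m)).+1) bcoef n k = \sum_(0 <= k < m) bcoef n k.
Proof.
move=> /andP[m0 mn]; have [h|h] := leqP m.-1 (n - m); first by rewrite prednK.
rewrite [RHS](@big_cat_nat _ _ _ (n - m).+1)//=; last by lia.
by rewrite (@sum_bcoef_sym n (n - m).+1 m) ?addr0//; lia.
Qed.

Lemma sum_bcoef_lnfact n :
  \sum_(k < n.+1) bcoef n k * lnfact R (n + k) =
  - \sum_(1 <= m < n.+1) (\sum_(0 <= k < m) bcoef n k) * lnn R (n + m).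
Proof.
have lf k : lnfact R (n + k) = lnfact R n + \sum_(1 <= m < k.+1) lnn R (n + m).
  elim: k => [|k ih]; first by rewrite addn0 big_geq// addr0.
  by rewrite addnS lnfactS ih [in RHS]big_nat_recr//= addrA -addnS.
under eq_bigr do rewrite lf mulrDr mulr_sumr.
rewrite big_split/= -mulr_suml sum_bcoef mul0r add0r.
rewrite -(big_mkord xpredT (fun k => \sum_(1 <= m < k.+1) bcoef n k * lnn R (n + m))).
transitivity (\sum_(0 <= k < n.+1) \sum_(1 <= m < n.+1 | (m <= k)%N) bcoef n k * lnn R (n + m)).
  rewrite big_nat [RHS]big_nat; apply: eq_bigr => k /andP[_ kn].
  by rewrite (@big_nat_widen _ _ _ 1 k.+1 n.+1)//; apply: eq_bigl => m; rewrite ltnS.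
transitivity (\sum_(0 <= k < n.+1) \sum_(1 <= m < n.+1)
    if (m <= k)%N then bcoef n k * lnn R (n + m) else 0).
  by apply: eq_bigr => k _; rewrite big_mkcond.
rewrite exchange_big/= -sumrN big_nat [RHS]big_nat; apply: eq_bigr => m /andP[m0 mn].
rewrite (@big_cat_nat _ _ _ m)//= ?(ltnW mn)// big_nat big1 ?add0r; last first.
  by move=> k /andP[_ km]; rewrite leqNgt km.
rewrite -mulNr.
have <- : \sum_(m <= k < n.+1) bcoef n k = - \sum_(0 <= k < m) bcoef n k.
  apply/eqP; rewrite -addr_eq0 addrC -big_cat_nat//= ?(ltnW mn)//.
  by rewrite big_mkord sum_bcoef.
rewrite mulr_suml big_nat [RHS]big_nat; apply: eq_bigr => k /andP[mk _].
by rewrite mk.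
Qed.

(** For k <= n - k, [- bcoef n k] is 2 'C(n, k)^2 times the sum of 1 / j over k < j <= n - k; with
    the factor d_2n these are the exponents in S_n. *)
Lemma ln_sondowS n : (0 < n)%N -> ln (sondowS n)%:R =
  (lcm_upto n.*2)%:R * \sum_(k < n.+1) bcoef n k * lnfact R (n + k).
Proof.
move=> n0; rewrite sum_bcoef_lnfact -/(lnn R _) /sondowS.
have e0 m i : (0 < (n + m) ^ i)%N by rewrite expn_gt0 addn_gt0 n0.
rewrite lnn_prod; last by move=> m; do 2!apply: prodn_gt0 => ?.
rewrite -sumrN mulr_sumr big_nat [RHS]big_nat; apply: eq_bigr => m /andP[m0 mn].
rewrite lnn_prod; last by move=> k; apply: prodn_gt0 => ?.
rewrite -mulNr mulrA -sum_bcoef_minn ?m0// -sumrN mulr_sumr mulr_suml.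
rewrite big_nat [RHS]big_nat; apply: eq_bigr => k /andP[_ km].
have kn : (k <= n - k)%N by move: km; rewrite ltnS leq_min; lia.
rewrite lnn_prod// bcoefE; last by lia.
transitivity (\sum_(k.+1 <= j < (n - k).+1)
   (2 * (lcm_upto n.*2)%:R * ('C(n, k) ^ 2)%:R * lnn R (n + m)) * j%:R^-1).
  rewrite big_nat [RHS]big_nat; apply: eq_bigr => j /andP[kj jn].
  rewrite lnnX ?addn_gt0 ?n0// natrM.
  have jd : (j %| 2 * lcm_upto n.*2)%N.
    by apply: dvdn_mull; apply: dvdn_lcm_upto; lia.
  have j0 : j%:R != 0 :> R by rewrite pnatr_eq0; lia.
  have -> : (2 * lcm_upto n.*2 %/ j)%:R = 2 * (lcm_upto n.*2)%:R / j%:R :> R.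
    by apply: (mulIf j0); rewrite divfK// -!natrM divnK.
  by ring.
rewrite -mulr_sumr.
have -> : \sum_(k.+1 <= j < (n - k).+1) j%:R^-1 = harm R (n - k) - harm R k.
  rewrite /harm [in X in X - _](@big_cat_nat _ _ _ k.+1)//=.
  by rewrite addrAC subrr add0r.
by ring.
Qed.

Lemma lcm_upto_harm n m : (m <= n)%N ->
  (lcm_upto n)%:R * harm R m = (\sum_(1 <= j < m.+1) lcm_upto n %/ j)%N%:R.
Proof.
move=> mn; rewrite natr_sum /harm mulr_sumr [LHS]big_nat [RHS]big_nat.
apply: eq_bigr => j /andP[j0 jm].
have jd : (j %| lcm_upto n)%N by apply: dvdn_lcm_upto; lia.
have j0' : j%:R != 0 :> R by rewrite pnatr_eq0 -lt0n.
by apply: (mulIf j0'); rewrite divfK// -natrM divnK.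
Qed.

Lemma linear_form_sondow n : (0 < n)%N -> exists A : nat,
  (lcm_upto n.*2)%:R * linear_form R n =
  (lcm_upto n.*2 * 'C(n.*2, n))%N%:R * euler_gamma R - A%:R + ln (sondowS n)%:R.
Proof.
move=> n0; exists (\sum_(k < n.+1) 'C(n, k) ^ 2 *
   \sum_(1 <= j < (n + k).+1) lcm_upto n.*2 %/ j)%N.
rewrite ln_sondowS// /linear_form mulrDr mulrBr natrM mulrA; congr (_ - _ + _).
rewrite natr_sum mulr_sumr; apply: eq_bigr => k _.
rewrite acoef_sqr [in RHS]natrM -lcm_upto_harm; last first.
  by rewrite -addnn leq_add2l -ltnS.
by ring.
Qed.

Lemma dist_int_le (t : R) (m : int) : dist_int t <= `|t - m%:~R|.
Proof.
apply: ge_inf; last by exists m.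
by exists 0 => _ [k _ <-].
Qed.

Lemma dist_int_ln_sondowS n (p : int) q : (0 < n)%N -> (0 < q <= n.*2)%N ->
  dist_int (ln (sondowS n)%:R) <=
  (lcm_upto n.*2)%:R * tail_scale R n ^+ 2 +
  (lcm_upto n.*2 * 'C(n.*2, n))%N%:R * `|euler_gamma R - p%:~R / q%:R|.
Proof.
move=> n0 qn; have [A eA] := linear_form_sondow n0.
set D := (_ * 'C(_, _))%N in eA *.
have qD : (q %| D)%N by rewrite dvdn_mulr// dvdn_lcm_upto.
have q0 : q%:R != 0 :> R by rewrite pnatr_eq0; lia.
have eD : D%:R = (D %/ q)%:R * q%:R :> R by rewrite -natrM divnK.
apply: le_trans (dist_int_le _ (A%:Z - p * (D %/ q)%:Z)) _.
have -> : ln (sondowS n)%:R - (A%:Z - p * (D %/ q)%:Z)%:~R =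
   (lcm_upto n.*2)%:R * linear_form R n - D%:R * (euler_gamma R - p%:~R / q%:R).
  by rewrite eA rmorphB rmorphM/= eD -!pmulrn; field.
apply: le_trans (ler_normB _ _) _.
have /andP[l0 l1] := @linear_form_itv R n n0.
rewrite normrM [X in _ + X]normrM !normr_nat (ger0_norm l0).
by rewrite lerD2r; apply: ler_wpM2l.
Qed.

End SondowProduct.

(** * Exponential size of the central binomial coefficient *)

Section Asymptotics.
Context {R : realType}.
Implicit Types (n : nat).

Lemma central_bin_rec n : (n.+1 * 'C(n.+1.*2, n.+1) = 2 * n.*2.+1 * 'C(n.*2, n))%N.
Proof.
have h1 := mul_bin_diag n.+1.*2 n; have h2 := mul_bin_down n.*2.+1 n.
rewrite /= in h1 h2.
have e : (n.*2.+1 - n = n.+1)%N by lia.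
rewrite e in h2; rewrite -h1 -mulnA h2; lia.
Qed.

Lemma central_bin_bounds n : ('C(n.*2, n) <= 4 ^ n)%N /\ (4 ^ n <= n.*2.+1 * 'C(n.*2, n))%N.
Proof.
elim: n => [|n [i1 i2]]; first by rewrite bin0.
have h := central_bin_rec n.
split; rewrite expnS -(leq_pmul2l (ltn0Sn n)).
  rewrite h; apply: leq_trans (leq_mul (leqnn _) i1) _.
  by rewrite [leqRHS]mulnA leq_mul2r; apply/orP; right; lia.
rewrite [leqRHS]mulnCA h; apply: leq_trans (leq_mul (leqnn _) (leq_mul (leqnn 4) i2)) _.
rewrite !mulnA leq_mul2r; apply/orP; right; nia.
Qed.

Lemma tail_scale_ge0 n : 0 <= tail_scale R n.
Proof. by rewrite /tail_scale divr_ge0. Qed.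

Lemma tail_scale_le n : tail_scale R n <= expR (2 * lnn R n.*2.+1 - n.*2%:R * ln 2).
Proof.
have [_ h] := central_bin_bounds n.
have C0 : 0 < 'C(n.*2, n)%:R :> R by rewrite ltr0n bin_gt0; lia.
have e : expR (2 * lnn R n.*2.+1 - n.*2%:R * ln 2) = n.*2.+1%:R ^+ 2 / (4 ^ n)%:R.
  rewrite expRB !expRM_natl !lnK ?posrE ?ltr0n//.
  by rewrite natrX -[in RHS](_ : 2 ^+ 2 = 4 :> R) -?exprM ?mul2n//; ring.
rewrite e /tail_scale ler_pdivrMr// mulrAC ler_pdivlMr ?ltr0n ?expn_gt0//.
rewrite -!natrX -!natrM ler_nat.
have : (n.+1 <= n.*2.+1)%N by lia.
move: h; set C := 'C(_, _); set m := n.*2.+1; set F := (4 ^ n)%N; nia.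
Qed.

(** Gives e^2 < 16 with a margin, 4 log 2 >= 7 / 3, so that d_2n 'C(2n, n)^-2 decays. *)
Lemma ln2_gt : 7 / 12 <= ln 2 :> R.
Proof.
have -> : 2 = 4 / 3 * (3 / 2) :> R by field.
rewrite lnM ?posrE//; try lra.
have h1 : 4^-1 <= ln (4 / 3) :> R.
  have := @ln_sub_le R (4 / 3) 1 ltac:(lra) ltac:(lra); rewrite ln1; lra.
have h2 : 3^-1 <= ln (3 / 2) :> R.
  have := @ln_sub_le R (3 / 2) 1 ltac:(lra) ltac:(lra); rewrite ln1; lra.
lra.
Qed.

End Asymptotics.

Lemma uphalf_bounds (a b c q : nat) : (0 < c)%N -> (a + b + c.*2 <= q)%N ->
  [/\ (q <= (uphalf q).*2)%N, ((uphalf q).*2 <= q.+1)%N, (0 < q)%N, (c <= uphalf q)%N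
    & [/\ (uphalf q <= q)%N, (a <= q)%N & (b <= q)%N]].
Proof.
move=> c0 h; have := odd_double_half q; rewrite uphalf_half.
by case: (odd q) => /= e; split; try split; lia.
Qed.

(** * The lower bound for |gamma - p / q| *)

Section Gap.
Context {R : realType}.
Implicit Types (n q : nat).

Lemma dist_int_lower (t : nat -> R) (eta : R) : 0 < eta ->
  (fun n => ((n%:R^-1)%:E * lne (dist_int (t n))%:E)%E) @ \oo --> (0 : \bar R)%E ->
  exists2 n0 : nat, (0 < n0)%N &
    forall n, (n0 <= n)%N -> expR (- (eta * n%:R)) < dist_int (t n).
Proof.
move=> eta0 ht.
have : nbhs (0 : \bar R)%E [set y | ((- eta)%:E < y)%E].
  apply: open_nbhs_nbhs; split; first exact: open_ereal_gt_ereal.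
  by rewrite /= lte_fin oppr_lt0.
move=> /ht[n0 _ h]; exists n0.+1 => // n hn.
have : ((- eta)%:E < (n%:R^-1)%:E * lne (dist_int (t n))%:E)%E := h n (ltnW hn).
have n0' : 0 < n%:R :> R by rewrite ltr0n; lia.
have [d0|d0] := leP (dist_int (t n)) 0.
  by rewrite le0_lneNy ?lee_fin// gt0_muleNy// lte_fin invr_gt0.
rewrite lne_EFin// -EFinM lte_fin mulrC ltr_pdivlMr// mulNr => hl.
by rewrite -[ltRHS]lnK ?posrE// ltr_expR.
Qed.

Lemma gamma_approx_lower (eps : R) : 0 < eps ->
  (fun n => ((n%:R^-1)%:E * lne (dist_int (ln (sondowS n)%:R : R))%:E)%E)
    @ \oo --> (0 : \bar R)%E ->
  exists2 q0 : nat, (0 < q0)%N & forall (p : int) q, (q0 <= q)%N ->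
    `|euler_gamma R - p%:~R / q%:R| > ((2 * expR 1 + eps) ^+ q)^-1.
Proof.
move=> eps0 hS; set beta := 2 * expR 1 + eps.
have e2 : 2 <= expR 1 :> R by apply: le_trans (expR_ge1Dx 1); rewrite -natr1.
have beta0 : 0 < beta by rewrite /beta; lra.
(* b = log(beta / (2e)) is the exponential gain per unit of q. *)
set b := ln beta - (1 + ln 2).
have b0 : 0 < b.
  rewrite subr_gt0 -{1}(expRK (1 : R)) -lnM ?posrE ?expR_gt0// mulrC.
  by rewrite ltr_ln ?posrE ?mulr_gt0 ?expR_gt0// ltrDl.
(* The cap b / 4 leaves half of this gain once eta is spent on psi and on the lower bound for the
   distance. With 1 / 60 the other term, even times e^(eta n), has exponent n (2 - 7 / 3 + 11 eta) +
   O(1) <= - 3 n / 20 + O(1). *)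
set eta := Num.min (b / 4) (1 / 60).
have eta0 : 0 < eta by rewrite /eta lt_min !divr_gt0.
have eta1 : eta <= b / 4 by rewrite /eta ge_min lexx.
have eta2 : eta <= 1 / 60 by rewrite /eta ge_min lexx orbT.
have [D0 D00 hD0] := psi_asymptotic eta0.
have [D1 D10 hD1] := lnn_le_linear eta0.
have [n0 n00 hn0] := dist_int_lower eta0 hS.
(* These thresholds make q b / 2 and q / 20 exceed the additive constants of the two terms. *)
have [q1 q10 hq1] := exists_nat_gt ((4 + D0) / (b / 2)).
have [q2 q20 hq2] := exists_nat_gt ((D0 + 4 * eta + 4 * D1 + 1) * 20).
exists (q1 + q2 + n0.*2)%N; first by rewrite !addn_gt0 q10.
move=> p q hq; rewrite ltNge; apply/negP => hp.
set n := uphalf q.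
have [hn1 hn2 q0 n0n [hnq' q1q q2q]] := uphalf_bounds n00 hq; rewrite -/n in hn1 hn2 n0n hnq'.
have n_gt0 : (0 < n)%N by apply: leq_trans n0n.
have q_gt0 : (0 < q <= n.*2)%N by rewrite q0.
have := hn0 n n0n; rewrite ltNge => /negP; apply.
apply: le_trans (dist_int_ln_sondowS p n_gt0 q_gt0) _.
have dE : (lcm_upto n.*2)%:R = expR (psi R n.*2).
  by rewrite /psi /lnn lnK ?posrE ?ltr0n ?lcm_upto_gt0.
have CE : 'C(n.*2, n)%:R <= expR (n.*2%:R * ln 2) :> R.
  rewrite expRM_natl lnK ?posrE// -mul2n exprM -natrX -natrX ler_nat.
  by rewrite mul2n; have [] := central_bin_bounds n.
have bq : (beta ^+ q)^-1 = expR (- (q%:R * ln beta)).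
  by rewrite expRN expRM_natl lnK ?posrE.
have n2 : n.*2%:R = 2 * n%:R :> R by rewrite -mul2n natrM.
have hq' : 2 * n%:R <= q%:R + 1 :> R by rewrite -n2 natr1 ler_nat.
have hq'' : q%:R <= 2 * n%:R :> R by rewrite -n2 ler_nat.
have hnq : n%:R <= q%:R :> R by rewrite ler_nat.
have qge : q1%:R <= q%:R :> R by rewrite ler_nat.
have qge' : q2%:R <= q%:R :> R by rewrite ler_nat.
have l2 := @ln2_gt R; have l2' : ln 2 <= 1 :> R.
  by rewrite -[leRHS]expRK ler_ln ?posrE ?expR_gt0.
have hpsi := hD0 n.*2; rewrite n2 in hpsi.
have x0 : 0 <= n%:R :> R by [].
have y0 : 0 <= q%:R :> R by [].
(* The -1 leaves room to add two such terms, since 2 <= e. *)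
set E := - (eta * n%:R) - 1.
have b1 : (lcm_upto n.*2)%:R * tail_scale R n ^+ 2 <= expR E.
  have h1 : tail_scale R n ^+ 2 <= expR (2 * (2 * lnn R n.*2.+1 - n.*2%:R * ln 2)).
    rewrite expRM_natl; apply: lerXn2r; rewrite ?nnegrE ?tail_scale_ge0 ?expR_ge0//.
    exact: tail_scale_le.
  rewrite dE; apply: le_trans (ler_wpM2l (expR_ge0 _) h1) _.
  rewrite -expRD ler_expR n2 /E.
  have := hD1 n.*2.+1; rewrite -[n.*2.+1%:R]natr1 n2.
  have : n%:R * (7 / 12) <= n%:R * ln 2 :> R by apply: ler_wpM2l.
  have : eta * n%:R <= 1 / 60 * n%:R by apply: ler_wpM2r.
  lra.
have b2 : (lcm_upto n.*2 * 'C(n.*2, n))%N%:R * `|euler_gamma R - p%:~R / q%:R| <= expR E.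
  rewrite natrM dE -mulrA.
  have h : 'C(n.*2, n)%:R * `|euler_gamma R - p%:~R / q%:R| <=
      expR (n.*2%:R * ln 2) * expR (- (q%:R * ln beta)).
    by apply: ler_pM => //; rewrite -bq.
  apply: le_trans (ler_wpM2l (expR_ge0 _) h) _.
  rewrite -!expRD ler_expR n2 /E.
  have lb : ln beta = b + (1 + ln 2) by rewrite /b subrK.
  rewrite lb.
  have h1 : (1 + eta + ln 2) * (2 * n%:R) <= (1 + eta + ln 2) * (q%:R + 1).
    by apply: ler_wpM2l => //; lra.
  have h2 : eta * n%:R <= eta * q%:R by apply: ler_wpM2l => //; exact: ltW.
  have h3 : eta * q%:R <= b / 4 * q%:R by apply: ler_wpM2r.
  have h4 : 4 + D0 < q%:R * (b / 2).
    rewrite -ltr_pdivrMr; last by lra.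
    exact: lt_le_trans hq1 qge.
  lra.
apply: le_trans (lerD b1 b2) _.
have -> : expR (- (eta * n%:R)) = expR E * expR 1 by rewrite -expRD /E subrK.
have := ler_wpM2l (expR_ge0 E) e2; lra.
Qed.

End Gap.

(** * Irrationality bases *)

Section IrrationalityBase.
Context {R : realType}.
Implicit Types (alpha beta : R) (q : nat).

(** A rational a / b equals a q0 / (b q0), an approximation with error 0 and denominator at least
    q0. *)
Lemma irrational_of_bases alpha beta : irrationality_bases alpha beta -> irrational alpha.
Proof.
move=> [b1 hb] /rationalP[a [b e]].
have [q0 q00 hq] := hb 1 ltr01.
(* For b = 0 the quotient is 0, and 0 / [q0] serves instead. *)
have [bE|b0] := eqVneq b 0%N.
  have := hq 0 q0 (leqnn _); rewrite e bE invr0 mulr0 mul0r subrr normr0 ltNge.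
  by rewrite invr_ge0 exprn_ge0// addr_ge0// (le_trans ler01).
have := hq (a * q0%:Z) (b * q0)%N; rewrite leq_pmull ?lt0n// => /(_ isT).
have -> : (a * q0%:Z)%:~R / (b * q0)%N%:R = alpha.
  rewrite e rmorphM/= natrM -pmulrn; field.
  by rewrite !pnatr_eq0 b0 -lt0n q00.
rewrite subrr normr0 ltNge invr_ge0 exprn_ge0// addr_ge0// (le_trans ler01)//.
Qed.

(** The infimum of the admissible bases is admissible: given eps, a base x < inf + eps / 2 serves,
    since x + eps / 2 <= inf + eps. Hence the least base exists and [xget] does not fall back to
    +oo. *)
Lemma irrationality_base_le alpha beta : irrationality_bases alpha beta ->
  (irrationality_base alpha <= beta%:E)%E.
Proof.
move=> hb; set B := irrationality_bases alpha.
have Binf : has_inf B by split; [exists beta|exists 1 => x []].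
have least : (B `&` lbound B) (inf B).
  split; last by apply: ge_inf; case: Binf.
  split; first by apply: lb_le_inf; [exists beta|move=> x []].
  move=> eps eps0; have e2 : 0 < eps / 2 by rewrite divr_gt0.
  have [x [x1 hx] xl] := inf_adherent e2 Binf.
  have [q0 q00 hq] := hx _ e2; exists q0 => // p q hpq.
  apply: le_lt_trans (hq p q hpq).
  have x2 : 0 < x + eps / 2 by lra.
  have h : x + eps / 2 <= inf B + eps by lra.
  by rewrite lef_pV2 ?posrE ?exprn_gt0// ?lerXn2r ?nnegrE ?(ltW x2)//; lra.
rewrite /irrationality_base.
have [y [yB ylb] <-] := @xgetI _ +oo%E [set x%:E | x in B `&` lbound B] (inf B)%:E
  (ex_intro2 _ _ (inf B) least erefl).
by rewrite lee_fin; apply: ylb.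
Qed.

End IrrationalityBase.

(* [lne] takes the value -oo at 0, so the hypothesis includes that
   ||log S_n|| is nonzero for all large n. *)
Theorem theorem1 (R : realType)
    (hS : (fun n : nat =>
             ((n%:R^-1)%:E * lne (dist_int (ln (sondowS n)%:R : R))%:E)%E)
          @ \oo --> (0 : \bar R)%E) :
  [/\ irrational (euler_gamma R),
      ~ super_liouville (euler_gamma R),
      (irrationality_base (euler_gamma R) <= (2 * expR 1)%:E)%E
    & forall eps : R, 0 < eps ->
        exists2 q0 : nat, (0 < q0)%N &
          forall (p : int) (q : nat), (q0 <= q)%N ->
            `|euler_gamma R - p%:~R / q%:R| > ((2 * expR 1 + eps) ^+ q)^-1].
Proof.
have base : irrationality_bases (euler_gamma R) (2 * expR 1).
  split; last by move=> eps eps0; exact: gamma_approx_lower.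
  by have := @expR_ge1Dx R 1; lra.
split.
- exact: irrational_of_bases base.
- by case=> _ B0; move: base; rewrite B0.
- exact: irrationality_base_le.
- by case: base.
Qed.
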